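(* For every $n$ and $F\in\mathcal{F}_n$, $$|\mathcal{M}_F(123,321)|=\begin{cases}2^{\eta(F)}&\text{if }F\in\mathcal{F}_n^{<5},\\ 0&\text{otherwise.}\end{cases}$$ Moreover $$\sum_{n\ge0}|\mathcal{M}_n(123,321)|z^n=\frac{1-5z+2z^2}{1-6z+5z^2},\quad\text{so}\quad |\mathcal{M}_n(123,321)|=\frac{5^{n-1}+1}{2}\ (n\ge1),$$ and $$\sum_{n\ge0}|\mathcal{P}_n(123,321)|z^n=\frac{1-10z+32z^2-37z^3+12z^4}{(1-z)(1-10z+31z^2-30z^3+z^4)}.$$
   Context: A Dyck path of semilength $n$ is a lattice path from $(0,n)$ to $(n,0)$ with unit east and south steps never going strictly below $y=n-x$; its height sequence $h_0\dots h_{2n}$ has $h_0=0$ and $h_{i+1}=h_i+1$ for an east step, $h_i-1$ for a south step. Its height is $\max_i h_i$, and $\eta(D)=|\{i:h_i=2\}|$. $\mathcal{F}_n$ is the set of Ferrers boards whose border $D_F$ is such a path; $\eta(F)=\eta(D_F)$; $\mathcal{F}_n^{<5}$ is the set of $F\in\mathcal{F}_n$ whose border has height less than $5$. Perfect matchings of $[2n]$: sets of $n$ disjoint pairs $(i,j)$, $i<j$; the shape of $M$ is the board in $\mathcal{F}_n$ whose border is obtained reading $1,\dots,2n$ with an east step per opener and a south step per closer. $M$ avoids $\tau\in S_k$ if there are no $i_1<\dots<i_{2k}$ with all pairs $(i_a,i_{2k+1-\tau(a)})$ in $M$. $\mathcal{M}_F(\sigma,\tau)$, $\mathcal{M}_n(\sigma,\tau)$: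 matchings of shape $F$, resp. of $[2n]$, avoiding both patterns. Set partitions of $[n]$: arcs $(i_1,i_2),\dots,(i_{a-1},i_a)$ for each block $\{i_1<\dots<i_a\}$; avoidance defined as for matchings with arcs; $\mathcal{P}_n(\sigma,\tau)$ the partitions of $[n]$ avoiding both. *)

(* Defs.v *)
From mathcomp Require Import all_boot all_order all_fingroup all_algebra.
Set Implicit Arguments.
Unset Strict Implicit.
Unset Printing Implicit Defensive.

Import Order.TTheory GRing.Theory Num.Theory.
Local Open Scope nat_scope.

(** * Lattice paths *)

(* A lattice path is given by its word of unit steps. *)
Definition step := bool.
Definition east : step := true.
Definition south : step := false.

Definition move (p : int * int) (s : step) : int * int :=
  if s == east then (p.1 + 1, p.2)%R else (p.1, p.2 - 1)%R.

Definition path_points (p0 : int * int) (w : seq step) : seq (int * int) :=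
  p0 :: scanl move p0 w.

Definition dyck_path (n : nat) (w : seq step) : bool :=
  let pts := path_points (0%R, n%:Z%R) w in
  (last (0%R, n%:Z%R) pts == (n%:Z%R, 0%R)) &&
  all (fun p : int * int => (n%:Z - p.1 <= p.2)%R) pts.

(* The height sequence [h_0, ..., h_(size w)]. *)
Definition heights (w : seq step) : seq int :=
  0%R :: scanl (fun (h : int) (s : step) =>
                  if s == east then (h + 1)%R else (h - 1)%R) 0%R w.

(* The initial value 0 is harmless, because h_0 = 0. *)
Definition path_height (w : seq step) : int :=
  (\big[Order.max/0]_(h <- heights w) h)%R.

Definition path_eta (w : seq step) : nat := count_mem 2%R (heights w).

(** * Ferrers boards *)

(* A board is the list of its (positive) row lengths, from the longest row,
   which lies on the x-axis, upwards. *)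
Definition board := seq nat.
Definition ferrers (F : board) : bool := sorted geq F && (0 \notin F).

(* The border goes from (0, number of rows) down to (length of the bottom row,
   0): each row, starting with the top one, contributes one east step for every
   cell by which it is longer than the row above it, then one south step. *)
Definition border (F : board) : seq step :=
  flatten (pairmap (fun a b => rcons (nseq (b - a) east) south) 0 (rev F)).

Definition dyck_board (n : nat) (F : board) : bool :=
  ferrers F && dyck_path n (border F).

Definition board_eta (F : board) : nat := path_eta (border F).

Definition dyck_board_lt (h : nat) (n : nat) (F : board) : bool :=
  dyck_board n F && (path_height (border F) < h%:Z)%R.

(** * Pattern avoidance *)

(* Positions are 0-based, so [2k+1-tau(a)] becomes [2k-1-tau(a)], which is
   [rev_ord] in ['I_(k + k)]. *)
Definition contains_pattern (m k : nat) (A : {set 'I_m * 'I_m}) (tau : 'S_k)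
    : bool :=
  [exists i : {ffun 'I_(k + k) -> 'I_m},
    [forall x : 'I_(k + k), forall y : 'I_(k + k),
       (x < y) ==> (i x < i y)] &&
    [forall a : 'I_k, (i (lshift k a), i (rev_ord (lshift k (tau a)))) \in A]].

Definition avoids (m k : nat) (A : {set 'I_m * 'I_m}) (tau : 'S_k) : bool :=
  ~~ contains_pattern A tau.

Definition pat123 : 'S_3 := 1%g.
Definition pat321 : 'S_3 := perm (@rev_ord_inj 3).

(** * Perfect matchings *)

Definition perfect_matching (n : nat) (M : {set 'I_(2 * n) * 'I_(2 * n)})
    : bool :=
  [&& #|M| == n,
      [forall p in M, p.1 < p.2] &
      [forall p in M, forall q in M,
        (p != q) ==> [disjoint [set p.1; p.2] & [set q.1; q.2]]]].

Definition opener (m : nat) (M : {set 'I_m * 'I_m}) (i : 'I_m) : bool :=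
  [exists j, (i, j) \in M].

Definition matching_word (m : nat) (M : {set 'I_m * 'I_m}) : seq step :=
  [seq (if opener M i then east else south) | i <- enum 'I_m].

Definition has_shape (n : nat) (F : board) (M : {set 'I_(2 * n) * 'I_(2 * n)})
    : bool :=
  dyck_board n F && (border F == matching_word M).

Definition matchings (n k l : nat) (sigma : 'S_k) (tau : 'S_l)
    : {set {set 'I_(2 * n) * 'I_(2 * n)}} :=
  [set M | [&& perfect_matching M, avoids M sigma & avoids M tau]].

Definition matchings_of_shape (n : nat) (F : board) (k l : nat)
    (sigma : 'S_k) (tau : 'S_l) : {set {set 'I_(2 * n) * 'I_(2 * n)}} :=
  [set M in matchings n sigma tau | has_shape F M].

(** * Set partitions *)

(* Pairs of consecutive elements of a common block. *)
Definition arcs (n : nat) (P : {set {set 'I_n}}) : {set 'I_n * 'I_n} :=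
  [set p | [exists B in P,
     [&& p.1 \in B, p.2 \in B, p.1 < p.2 &
         [forall x in B, ~~ (p.1 < x < p.2)]]]].

Definition partitions (n k l : nat) (sigma : 'S_k) (tau : 'S_l)
    : {set {set {set 'I_n}}} :=
  [set P | [&& partition P [set: 'I_n],
               avoids (arcs P) sigma & avoids (arcs P) tau]].

(** * Formal power series over the rationals *)

Local Open Scope ring_scope.

Definition fps := nat -> rat.

Definition fps_of_poly (p : {poly rat}) : fps := fun n => p`_n.

Definition fps_mul (a b : fps) : fps := fun n => \sum_(i < n.+1) a i * b (n - i)%N.

(* The coefficients 0, ..., n of the inverse of [a], assuming [a 0 != 0];
   see [fps_mulrV] and [fps_inv_unique]. *)
Fixpoint fps_inv_coefs (a : fps) (n : nat) : seq rat :=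
  if n is m.+1 then
    let s := fps_inv_coefs a m in
    rcons s (- (\sum_(i < m.+1) a i.+1 * s`_(m - i)) / a 0%N)
  else [:: (a 0%N)^-1].

Definition fps_inv (a : fps) : fps := fun n => (fps_inv_coefs a n)`_n.

Definition fps_div (a b : fps) : fps := fps_mul a (fps_inv b).

Lemma size_fps_inv_coefs a n : size (fps_inv_coefs a n) = n.+1.
Proof. by elim: n => //= n IHn; rewrite size_rcons IHn. Qed.

Lemma nth_fps_inv_coefs a n i :
  (i <= n)%N -> (fps_inv_coefs a n)`_i = fps_inv a i.
Proof.
elim: n => [|n IHn]; first by rewrite leqn0 => /eqP->.
rewrite leq_eqVlt => /predU1P[-> //|]; rewrite ltnS => le_in.
by rewrite /= nth_rcons size_fps_inv_coefs ltnS le_in IHn.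
Qed.

Lemma fps_invS a n :
  fps_inv a n.+1 = - (\sum_(i < n.+1) a i.+1 * fps_inv a (n - i)%N) / a 0%N.
Proof.
rewrite {1}/fps_inv /= nth_rcons size_fps_inv_coefs ltnn eqxx.
congr (- _ / _); apply: eq_bigr => i _.
by rewrite nth_fps_inv_coefs // leq_subr.
Qed.

Lemma fps_mul_recl a b n :
  fps_mul a b n = a 0%N * b n + \sum_(i < n) a i.+1 * b (n - i.+1)%N.
Proof. by rewrite /fps_mul big_ord_recl subn0. Qed.

Lemma fps_mulrV a :
  a 0%N != 0 -> fps_mul a (fps_inv a) =1 fps_of_poly 1.
Proof.
move=> a0 [|n]; rewrite fps_mul_recl /fps_of_poly coef1.
  by rewrite big_ord0 addr0 /fps_inv /= divff.
by rewrite fps_invS mulrC divfK // addNr.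
Qed.

Lemma fps_inv_unique a b :
  a 0%N != 0 -> fps_mul a b =1 fps_of_poly 1 -> b =1 fps_inv a.
Proof.
move=> a0 ab n; have [k] := ubnP n; elim: k n => // k IHk n ltnk.
apply: (mulfI a0); have := fps_mulrV a0 n; rewrite -ab !fps_mul_recl => eq_ab.
apply/esym; apply: (addIr (\sum_(i < n) a i.+1 * fps_inv a (n - i.+1)%N)).
rewrite eq_ab; congr (_ + _); apply: eq_bigr => i _; rewrite IHk //.
rewrite ltnS in ltnk; apply: leq_trans ltnk; rewrite ltn_subrL /=.
exact: leq_ltn_trans (ltn_ord i).
Qed.

(* Main.v *)
Require Import Defs.
From mathcomp Require Import all_boot all_order all_fingroup all_algebra.
From mathcomp Require Import zify ring.
Set Implicit Arguments.
Unset Strict Implicit.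
Unset Printing Implicit Defensive.

(* The patterns 123 and 321 are the 3-nesting and the 3-crossing.  Scan the
   positions from left to right, choosing at each closer which open arc to close.
   The arcs closed so far only restrict the future by forcing some pairs of open
   arcs to nest and others to cross.  By Erdos-Szekeres five open arcs cannot all
   be closed, and a state is also dead when it forces a pair both ways or a whole
   triple one way; in every other reachable state at most one pair is forced.
   Such a state has v times 2 ^ (number of later visits to height 2) completions,
   where v = 2 if there are at least two open arcs and no forced pair, and v = 1
   otherwise: one step of the scan preserves this.
   A set partition is determined by its arcs, and the arc sets that occur are the
   diagrams in which a position may be an opener, a closer, both or neither.  So
   all three counts are weighted counts of paths of height at most 4, and the
   generating functions come from linear recurrences on the five heights. *)

Import Order.TTheory GRing.Theory Num.Theory.
Local Open Scope nat_scope.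

(* The factor contributed by a point of height [h] of the border: 2 at height 2,
   and 0 from height 5 on. *)
Definition visit (h : nat) : nat :=
  match h with 2 => 2 | 0 | 1 | 3 | 4 => 1 | _ => 0 end.

(* A pair [(c, o)] tells whether a position closes an arc and whether it opens
   one; the entries of [al] are the types allowed at the successive positions.  A
   position that does both closes an arc before it opens one. *)
Fixpoint weight (h : nat) (al : seq (pred (bool * bool))) : nat :=
  if al is a :: al' then
    \sum_(co : bool * bool | a co)
      (co.1 ==> (0 < h)) * (if co.1 then visit h.-1 else 1)
      * (if co.2 then visit (h - co.1).+1 else 1)
      * weight (h - co.1 + co.2) al'
  else h == 0.

(** * Diagrams and their completions *)

Section Diagrams.

Variable m : nat.
Implicit Types (A D : {set 'I_m * 'I_m}) (i j x y z : 'I_m) (s : seq 'I_m).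

(** The arc sets of set partitions are exactly the diagrams, by [diagram_arcs] and [arcs_surj];
    those of perfect matchings are singled out by [perfect_matchingE]. *)
Definition diagram D : bool :=
  [forall p in D, p.1 < p.2] &&
  [forall p in D, forall q in D,
     ((p.1 == q.1) || (p.2 == q.2)) ==> (p == q)].

(** The first excluded order of right ends is a 3-crossing, the pattern 321; the second is a
    3-nesting, the pattern 123. Six distinct ends are required, so arcs that merely meet at a
    position form neither. *)
Definition avoids3 D : bool :=
  [forall p in D, forall q in D, forall r in D,
     (p.1 < q.1 < r.1) ==>
     ~~ [&& r.1 < p.2, p.2 < q.2 & q.2 < r.2] &&
     ~~ [&& r.1 < r.2, r.2 < q.2 & q.2 < p.2]].

Lemma diagramP D :
  reflect [/\ forall i j, (i, j) \in D -> i < j,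
              forall i j j', (i, j) \in D -> (i, j') \in D -> j = j' &
              forall i i' j, (i, j) \in D -> (i', j) \in D -> i = i']
          (diagram D).
Proof.
apply: (iffP andP) => [[/forall_inP lt inj]|[lt injl injr]].
  have {}inj p q : p \in D -> q \in D -> (p.1 == q.1) || (p.2 == q.2) -> p = q.
    by move=> pD qD pq; apply/eqP; move/forall_inP/(_ p pD)/forall_inP/(_ q qD)/implyP: inj; apply.
  split=> [i j /lt //|i j j' ijD ij'D|i i' j ijD i'jD].
    by have := inj _ _ ijD ij'D; rewrite eqxx => /(_ isT) [].
  by have := inj _ _ ijD i'jD; rewrite eqxx orbT => /(_ isT) [].
split; first by apply/forall_inP => -[i j] /lt.
apply/forall_inP => -[i j] ijD; apply/forall_inP => -[i' j'] ijD' /=.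
apply/implyP => /orP[]/eqP e; subst.
  by rewrite (injl _ _ _ ijD ijD').
by rewrite (injr _ _ _ ijD ijD').
Qed.

Lemma avoids3P D :
  reflect (forall i i' i'' j j' j'',
             (i, j) \in D -> (i', j') \in D -> (i'', j'') \in D ->
             i < i' -> i' < i'' ->
             ~ [/\ i'' < j, j < j' & j' < j''] /\
             ~ [/\ i'' < j'', j'' < j' & j' < j])
          (avoids3 D).
Proof.
apply: (iffP idP) => [/forall_inP av i i' i'' j j' j'' D1 D2 D3 l1 l2|av].
  have /forall_inP/(_ _ D2)/forall_inP/(_ _ D3)/implyP/= := av _ D1.
  rewrite l1 l2 => /(_ isT) /andP[/and3P H1 /and3P H2].
  by split.
apply/forall_inP => -[i j] D1; apply/forall_inP => -[i' j'] D2.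
apply/forall_inP => -[i'' j''] D3; apply/implyP => /= /andP[l1 l2].
have [H1 H2] := av _ _ _ _ _ _ D1 D2 D3 l1 l2.
by apply/andP; split; apply/and3P.
Qed.

Definition pos_type D i : bool * bool :=
  ([exists j, (j, i) \in D], [exists j, (i, j) \in D]).

(** Positions before [k] are left free, because [A] and [s] already record what happened there. *)
Definition allowed (al : seq (pred (bool * bool))) k D : bool :=
  [forall i : 'I_m, (k <= i) ==> nth xpred0 al i (pos_type D i)].

(* [A] consists of the arcs closed before position [k], and [s] of the left ends
   of the arcs still open there. *)
Definition completions al A s k : {set {set 'I_m * 'I_m}} :=
  [set D | [&& diagram D, avoids3 D, allowed al k D,
               [set p in D | p.2 < k] == A &
               [forall i, (i \in s) == (i < k) && [exists j : 'I_m, (k <= j) && ((i, j) \in D)]]]].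

Lemma completionsP al A s k D :
  reflect [/\ diagram D /\ avoids3 D, allowed al k D,
              forall i j, ((i, j) \in A) = ((i, j) \in D) && (j < k) &
              forall i, (i \in s) <-> (i < k /\ exists2 j : 'I_m, k <= j & (i, j) \in D)]
          (D \in completions al A s k).
Proof.
rewrite inE; apply: (iffP and5P) => [[dD aD alD /eqP AE /forallP sE]|[[dD aD] alD AE sE]].
  split=> // [i j|i]; first by rewrite -AE inE.
  rewrite (eqP (sE i)).
  split=> [/andP[ik /existsP[j /andP[kj ijD]]]|[-> [j kj ijD]]].
    by split=> //; exists j.
  by apply/existsP; exists j; rewrite kj.
split=> //.
  by apply/eqP/setP => -[i j]; rewrite inE AE.
apply/forallP => i; apply/eqP; apply/idP/andP => [/sE[ik [j kj ijD]]|[ik /existsP[j /andP[kj ijD]]]].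
  by split=> //; apply/existsP; exists j; rewrite kj.
by apply/sE; split=> //; exists j.
Qed.

Definition push (o : bool) k s : seq 'I_m := if o then rcons s k else s.

Lemma mem_push o k s i : (i \in push o k s) = o && (i == k) || (i \in s).
Proof. by case: o => //=; rewrite mem_rcons inE. Qed.

Lemma ord_leqVlt i j : (i <= j) = (i == j) || (i < j).
Proof. exact: leq_eqVlt. Qed.

(** * One position of the scan *)

Section Step.

Variables (al : seq (pred (bool * bool))) (A : {set 'I_m * 'I_m}).
Variables (s : seq 'I_m) (k : 'I_m).
Hypotheses (Us : uniq s) (s_lt : forall i, i \in s -> i < k).
Hypothesis A_lt : forall i j, (i, j) \in A -> j < k.

Lemma allowedS D :
  allowed al k D = nth xpred0 al k (pos_type D k) && allowed al k.+1 D.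
Proof.
apply/forallP/andP => [H|[H /forallP H'] i].
  split; first by have := H k; rewrite leqnn.
  apply/forallP => i; apply/implyP => ki; have := H i.
  by rewrite (ltnW ki).
apply/implyP; rewrite leq_eqVlt => /predU1P[/val_inj <- //|ki].
by have := H' i; rewrite ki.
Qed.

(** The four lemmas from here to [completions_skip_sup] split the completions of a state according
    to which open arc, if any, ends at [k] and whether an arc starts there. The successor state no
    longer restricts the type of [k], so the [nth] condition has to be supplied separately. *)
Lemma completions_close_sub x o D : x \in s ->
  D \in completions al ((x, k) |: A) (push o k (rem x s)) k.+1 ->
  [/\ nth xpred0 al k (pos_type D k) -> D \in completions al A s k,
      pos_type D k = (true, o) & (x, k) \in D].
Proof.
move=> xs /completionsP[[dD aD] alD AE sE].
have [lt injl injr] := diagramP _ dD.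
have xkD : (x, k) \in D by move: (AE x k); rewrite in_setU1 eqxx /= => /esym/andP[].
split=> //.
  move=> ak; apply/completionsP; split=> // [|i j|i]; first by rewrite allowedS ak.
    have := AE i j; rewrite in_setU1 ltnS => E.
    have [jk|jk|/val_inj jk] := ltngtP j k.
    - rewrite (ltnW jk) in E; rewrite -E.
      by case: eqP => // -[_ jk']; rewrite jk' ltnn in jk.
    - by rewrite andbF; apply/negbTE/negP => /A_lt; rewrite ltnNge (ltnW jk).
    - by rewrite andbF jk; apply/negbTE/negP => /A_lt; rewrite ltnn.
  split=> [i_s|[ik [j kj ijD]]].
    split; first exact: s_lt.
    have [->|ix] := eqVneq i x; first by exists k.
    have : i \in push o k (rem x s) by rewrite mem_push mem_rem_uniq // inE ix i_s orbT.
    by move/sE => [_ [j kj ijD]]; exists j => //; exact: ltnW.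
  move: kj; rewrite leq_eqVlt => /predU1P[/val_inj kj|kj].
    by subst; rewrite (injr _ _ _ ijD xkD).
  have /sE : i < k.+1 /\ exists2 j : 'I_m, k.+1 <= j & (i, j) \in D.
    by split; [exact: leqW | exists j].
  rewrite mem_push => /orP[/andP[_ /eqP ik']|/mem_rem //].
  by rewrite ik' ltnn in ik.
congr (_, _); first by apply/existsP; exists x.
apply/existsP/idP => [[j kjD]|oT].
  have /sE : k < k.+1 /\ exists2 j : 'I_m, k.+1 <= j & (k, j) \in D.
    by split; [exact: ltnSn | exists j => //; exact: lt].
  by rewrite mem_push eqxx andbT => /orP[//|/mem_rem/s_lt]; rewrite ltnn.
have : k \in push o k (rem x s) by rewrite mem_push oT eqxx.
by move/sE => [_ [j _ kjD]]; exists j.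
Qed.

Lemma completions_skip_sub o D :
  D \in completions al A (push o k s) k.+1 ->
  (nth xpred0 al k (pos_type D k) -> D \in completions al A s k) /\ pos_type D k = (false, o).
Proof.
move=> /completionsP[[dD aD] alD AE sE].
have [lt injl injr] := diagramP _ dD.
have nk x : (x, k) \notin D.
  apply/negP => xkD; have := AE x k; rewrite xkD ltnSn /=.
  by move/A_lt; rewrite ltnn.
split=> //.
  move=> ak; apply/completionsP; split=> // [|i j|i]; first by rewrite allowedS ak.
    rewrite AE ltnS ord_leqVlt; case: eqP => //= ->.
    by rewrite (negbTE (nk _)) ?ltnn.
  split=> [i_s|[ik [j kj ijD]]].
    split; first exact: s_lt.
    have : i \in push o k s by rewrite mem_push i_s orbT.
    by move/sE => [_ [j kj ijD]]; exists j => //; exact: ltnW.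
  move: kj; rewrite leq_eqVlt => /predU1P[/val_inj kj|kj].
    by subst; rewrite (negbTE (nk _)) in ijD.
  have /sE : i < k.+1 /\ exists2 j : 'I_m, k.+1 <= j & (i, j) \in D.
    by split; [exact: leqW | exists j].
  rewrite mem_push => /orP[/andP[_ /eqP ik']|//].
  by rewrite ik' ltnn in ik.
congr (_, _); first by apply/negbTE; rewrite negb_exists; apply/forallP.
apply/existsP/idP => [[j kjD]|oT].
  have /sE : k < k.+1 /\ exists2 j : 'I_m, k.+1 <= j & (k, j) \in D.
    by split; [exact: ltnSn | exists j => //; exact: lt].
  by rewrite mem_push eqxx andbT => /orP[//|/s_lt]; rewrite ltnn.
have : k \in push o k s by rewrite mem_push oT eqxx.
by move/sE => [_ [j _ kjD]]; exists j.
Qed.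

Lemma completions_close_sup x D : D \in completions al A s k -> (x, k) \in D ->
  x \in s /\ D \in completions al ((x, k) |: A) (push (pos_type D k).2 k (rem x s)) k.+1.
Proof.
move=> /completionsP[[dD aD] alD AE sE] xkD.
have [lt injl injr] := diagramP _ dD.
have xs : x \in s by apply/sE; split; [exact: lt | exists k].
split=> //; apply/completionsP; split=> // [|i j|i].
- by move: alD; rewrite allowedS => /andP[].
- rewrite in_setU1 AE ltnS.
  have [jk|jk|/val_inj ->] := ltngtP j k; rewrite ?andbF ?andbT ?orbF.
  + by case: eqP => // -[_ jk']; rewrite jk' ltnn in jk.
  + by case: eqP => // -[_ jk']; rewrite jk' ltnn in jk.
  + by apply/eqP/idP => [[->//]|ikD]; rewrite (injr _ _ _ ikD xkD).
rewrite mem_push mem_rem_uniq // inE.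
split; first case/orP=> [/andP[/existsP[j kjD] /eqP->]|/andP[ix /sE[ik [j kj ijD]]]].
    by split=> //; exists j => //; exact: lt.
  split; [exact: leqW | exists j => //].
  move: kj; rewrite leq_eqVlt => /predU1P[/val_inj kj|//]; subst.
  by rewrite (injr _ _ _ ijD xkD) eqxx in ix.
move=> [ik [j kj ijD]]; apply/orP.
have [ik'|ik'] := eqVneq i k.
  by left; rewrite andbT; apply/existsP; exists j; rewrite -ik'.
right; apply/andP; split.
  by apply/eqP => ix; subst; rewrite (injl _ _ _ ijD xkD) ltnn in kj.
apply/sE; split; last by exists j => //; exact: ltnW.
by rewrite ltn_neqAle ik' -ltnS.
Qed.

Lemma completions_skip_sup D : D \in completions al A s k -> (pos_type D k).1 = false ->
  D \in completions al A (push (pos_type D k).2 k s) k.+1.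
Proof.
move=> /completionsP[[dD aD] alD AE sE] /= /negbT; rewrite negb_exists => /forallP nk.
have [lt injl injr] := diagramP _ dD.
apply/completionsP; split=> // [|i j|i].
- by move: alD; rewrite allowedS => /andP[].
- rewrite AE ltnS ord_leqVlt; case: eqP => //= ->.
  by rewrite (negbTE (nk _)) ?ltnn.
rewrite mem_push.
split; first case/orP=> [/andP[/existsP[j kjD] /eqP->]|/sE[ik [j kj ijD]]].
    by split=> //; exists j => //; exact: lt.
  split; [exact: leqW | exists j => //].
  move: kj; rewrite leq_eqVlt => /predU1P[/val_inj kj|//]; subst.
  by rewrite (negbTE (nk _)) in ijD.
move=> [ik [j kj ijD]]; apply/orP.
have [ik'|ik'] := eqVneq i k.
  by left; rewrite andbT; apply/existsP; exists j; rewrite -ik'.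
right; apply/sE; split; last by exists j => //; exact: ltnW.
by rewrite ltn_neqAle ik' -ltnS.
Qed.

(** Both sides are sums of indicators over all [D]. If [D] is a completion, exactly one choice on
    the right accounts for it: the actual type of [k] together with the actual arc ending at [k].
    Otherwise none does. *)
Lemma card_completions_step :
  #|completions al A s k| =
  \sum_(co : bool * bool | nth xpred0 al k co)
    if co.1 then \sum_(x <- s) #|completions al ((x, k) |: A) (push co.2 k (rem x s)) k.+1|
    else #|completions al A (push co.2 k s) k.+1|.
Proof.
have cardE (E : {set {set 'I_m * 'I_m}}) : #|E| = \sum_D (D \in E).
  by rewrite -sum1_card big_mkcond.
rewrite cardE.
under [RHS]eq_bigr => co _.
  rewrite (_ : (if _ then _ else _) = \sum_D (if co.1 then
    \sum_(x <- s) (D \in completions al ((x, k) |: A) (push co.2 k (rem x s)) k.+1)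
    else (D \in completions al A (push co.2 k s) k.+1))); last first.
    case: ifP => _; last exact: cardE.
    by rewrite exchange_big; apply: eq_bigr => x _; rewrite cardE.
  over.
rewrite exchange_big; apply: eq_bigr => D _.
have [DE|DnE] := boolP (D \in completions al A s k).
  have [_ + _ _] := completionsP _ _ _ _ _ DE; rewrite allowedS => /andP[ak _].
  rewrite (bigD1 (pos_type D k)) //= [X in _ + X]big1 ?addn0 => [|[[] o] /andP[_ ne]] /=.
  - have [/existsP[x xkD]|/negbTE ncl] := boolP [exists j, (j, k) \in D].
      have [xs DE'] := completions_close_sup DE xkD.
      rewrite (bigD1_seq x) //= DE' big1_seq // => y /andP[yx ys].
      case: (boolP (D \in _)) => // /(completions_close_sub ys) [_ _ ykD].
      have [/diagramP[_ _ injr] _] : diagram D /\ avoids3 D by case/completionsP: DE.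
      by rewrite (injr _ _ _ ykD xkD) eqxx in yx.
    by rewrite (completions_skip_sup DE).
  - rewrite big1_seq // => y /andP[_ ys].
    case: (boolP (D \in _)) => // /(completions_close_sub ys) [_ E _].
    by rewrite E eqxx in ne.
  - case: (boolP (D \in _)) => // /completions_skip_sub [_ E].
    by rewrite E eqxx in ne.
rewrite big1 // => -[[] o] ak /=.
  rewrite big1_seq // => y /andP[_ ys].
  case: (boolP (D \in _)) => // /(completions_close_sub ys) [H E _].
  by rewrite H ?E in DnE.
case: (boolP (D \in _)) => // /completions_skip_sub [H E].
by rewrite H ?E in DnE.
Qed.

End Step.

(** * States of the left-to-right scan *)

(* For open arcs starting at x < y, a closed arc (a, b) with a < x and y < b would
   complete a 3-crossing if x were closed before y, and one with y < a would
   complete a 3-nesting if y were closed before x.  An open arc is blocked if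
   closing it completes a forbidden triple. *)
Definition must_nest A x y : bool := [exists p in A, (p.1 < x) && (y < p.2)].
Definition must_cross A y : bool := [exists p in A, y < p.1].
Definition blocked A y : bool :=
  [exists p in A, exists q in A, (p.2 < q.2) &&
     ([&& p.1 < q.1, q.1 < y & y < p.2] || (y < q.1 < p.1))].

(** The new arc ends at [k], beyond every open left end, so closing [z] forces to nest exactly the
    pairs that lie to the right of [z]. *)
Lemma must_nest_close A x y z (k : 'I_m) : y < k ->
  must_nest ((z, k) |: A) x y = (z < x) || must_nest A x y.
Proof.
move=> yk; apply/exists_inP/orP => [[[i j]] /=|[zx|/exists_inP[p pA py]]].
- rewrite in_setU1 => /predU1P[[-> _] /andP[-> _]|ijA ijxy]; first by left.
  by right; apply/exists_inP; exists (i, j).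
- by exists (z, k); rewrite ?setU11 ?zx.
by exists p; rewrite // in_setU1 pA orbT.
Qed.

(** Dually, closing [z] forces to cross exactly the pairs that lie to the left of [z]. *)
Lemma must_cross_close A y z (k : 'I_m) :
  must_cross ((z, k) |: A) y = (y < z) || must_cross A y.
Proof.
apply/exists_inP/orP => [[[i j]] /=|[zx|/exists_inP[p pA py]]].
- rewrite in_setU1 => /predU1P[[-> _] ->|ijA ijxy]; first by left.
  by right; apply/exists_inP; exists (i, j).
- by exists (z, k); rewrite ?setU11.
by exists p; rewrite // in_setU1 pA orbT.
Qed.

(** The arc closed at [k] ends after all arcs of [A], so in a new blocking pair it is the later one.
    Hence [y] becomes blocked exactly when closing [z] before [y] violates the constraint on this
    pair. *)
Lemma blocked_close A y z (k : 'I_m) :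
  (forall i j, (i, j) \in A -> j < k) ->
  blocked ((z, k) |: A) y =
    [|| (z < y) && must_nest A z y, (y < z) && must_cross A z | blocked A y].
Proof.
move=> A_lt; apply/exists_inP/or3P.
  case=> -[i j] /= pA /exists_inP[[i' j']] /= qA /andP[jj'].
  have jk : j < k.
    move: qA; rewrite in_setU1 => /predU1P[[_ j'k]|/A_lt j'k]; last exact: ltn_trans j'k.
    by rewrite j'k in jj'.
  have {}pA : (i, j) \in A.
    by move: pA; rewrite in_setU1 => /predU1P[[_ jk']|//]; rewrite jk' ltnn in jk.
  move: qA; rewrite in_setU1 => /predU1P[[-> j'k]|qA].
    case/orP=> [/and3P[iz zy yj]|/andP[yz zi]].
      by apply: Or31; rewrite zy; apply/exists_inP; exists (i, j); rewrite ?iz.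
    by apply: Or32; rewrite yz; apply/exists_inP; exists (i, j).
  move=> H; apply: Or33; apply/exists_inP; exists (i, j) => //.
  by apply/exists_inP; exists (i', j') => //=; rewrite jj'.
case=> [/andP[zy /exists_inP[[i j] pA /= /andP[iz yj]]]|/andP[yz /exists_inP[[i j] pA /= zi]]|].
- exists (i, j); first by rewrite in_setU1 pA orbT.
  apply/exists_inP; exists (z, k); first exact: setU11.
  by rewrite /= iz zy yj (A_lt _ _ pA).
- exists (i, j); first by rewrite in_setU1 pA orbT.
  apply/exists_inP; exists (z, k); first exact: setU11.
  by rewrite /= zi yz (A_lt _ _ pA) orbT.
case/exists_inP=> p pA /exists_inP[q qA pq].
exists p; first by rewrite in_setU1 pA orbT.
by apply/exists_inP; exists q => //; rewrite in_setU1 qA orbT.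
Qed.

(** For crossings two conditions cover all three pairs of x < y < z, since [must_cross] depends only
    on the larger left end of a pair. *)
Definition dead A s : bool :=
  [|| has (blocked A) s,
      has (fun x => has (fun y => [&& x < y, must_nest A x y & must_cross A y]) s) s |
      has (fun x => has (fun y => has (fun z =>
        [&& x < y, y < z &
            [&& must_nest A x y, must_nest A y z & must_nest A x z] ||
            (must_cross A y && must_cross A z)]) s) s) s].

(** * Effect of the constraints on the remaining right ends *)

Section Closing.

Variables (al : seq (pred (bool * bool))) (A : {set 'I_m * 'I_m}).
Variables (s : seq 'I_m) (k : nat) (D : {set 'I_m * 'I_m}).
Hypothesis DE : D \in completions al A s k.

Lemma completions_closer x : x \in s -> exists2 j : 'I_m, k <= j & (x, j) \in D.
Proof. by case/completionsP: DE => _ _ _ sE /sE[]. Qed.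

Lemma completions_sub i j : (i, j) \in A -> (i, j) \in D /\ j < k.
Proof. by case/completionsP: DE => _ _ -> _ /andP[]. Qed.

Lemma completions_avoids : avoids3 D.
Proof. by case/completionsP: DE => -[]. Qed.

Lemma completions_lt x : x \in s -> x < k.
Proof. by case/completionsP: DE => _ _ _ sE /sE[]. Qed.

Lemma completions_neq x y (jx jy : 'I_m) :
  (x, jx) \in D -> (y, jy) \in D -> x < y -> jx != jy :> nat.
Proof.
have [/diagramP[_ _ injr] _] : diagram D /\ avoids3 D by case/completionsP: DE.
move=> xD yD xy; apply/eqP => /val_inj e; subst.
by rewrite (injr _ _ _ xD yD) ltnn in xy.
Qed.

(** If [x] were closed first, the witness in [A] and the arcs from [x] and [y] would end in the
    order in which they start, a 3-crossing. *)
Lemma must_nestP x y jx jy : (x, jx) \in D -> (y, jy) \in D ->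
  k <= jx -> k <= jy -> x < y -> must_nest A x y -> jy < jx.
Proof.
move=> xD yD kx ky xy /exists_inP[[i j] /completions_sub[ijD jk] /= /andP[ix yj]].
rewrite ltnNge leq_eqVlt (negbTE (completions_neq xD yD xy)) /=; apply/negP => lt.
have [+ _] := avoids3P _ completions_avoids _ _ _ _ _ _ ijD xD yD ix xy.
by case; split=> //; apply: leq_trans jk _.
Qed.

(** If [y] were closed first, the witness in [A] would lie inside the arc from [y], and that one
    inside the arc from [x], a 3-nesting. *)
Lemma must_crossP x y jx jy : (x, jx) \in D -> (y, jy) \in D ->
  k <= jx -> k <= jy -> x < y -> must_cross A y -> jx < jy.
Proof.
move=> xD yD kx ky xy /exists_inP[[i j] /completions_sub[ijD jk] /= yi].
have [/diagramP[lt _ _] _] : diagram D /\ avoids3 D by case/completionsP: DE.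
rewrite ltnNge leq_eqVlt eq_sym (negbTE (completions_neq xD yD xy)) /=; apply/negP => lt'.
have [_ +] := avoids3P _ completions_avoids _ _ _ _ _ _ xD yD ijD xy yi.
case; split=> //; [exact: lt | exact: leq_trans jk _].
Qed.

End Closing.

Lemma completions_dead al A s k : dead A s -> completions al A s k = set0.
Proof.
move=> dA; apply/setP => D; rewrite in_set0; apply/negP => DE.
have aD := avoids3P _ (completions_avoids DE).
case/or3P: dA => [/hasP[y ys]|/hasP[x xs /hasP[y ys /and3P[xy nxy cy]]]|].
- case/exists_inP=> -[i j] /(completions_sub DE)[ijD jk] /exists_inP[[i' j'] /(completions_sub DE)[ijD' jk']] /=.
  have [jy ky yD] := completions_closer DE ys.
  case/andP=> jj' /orP[/and3P[ii' i'y yj]|/andP[yi' i'i]].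
    have [+ _] := aD _ _ _ _ _ _ ijD ijD' yD ii' i'y.
    by case; split=> //; apply: leq_trans ky.
  have [/diagramP[lt _ _] _] : diagram D /\ avoids3 D by case/completionsP: DE.
  have [_ +] := aD _ _ _ _ _ _ yD ijD' ijD yi' i'i.
  by case; split=> //; [exact: lt | apply: leq_trans ky].
- have [jx kx xD] := completions_closer DE xs; have [jy ky yD] := completions_closer DE ys.
  have := must_nestP DE xD yD kx ky xy nxy; have := must_crossP DE xD yD kx ky xy cy.
  by move=> /ltn_trans h /h; rewrite ltnn.
case/hasP=> x xs /hasP[y ys /hasP[z zs /and3P[xy yz]]].
have [jx kx xD] := completions_closer DE xs; have [jy ky yD] := completions_closer DE ys.
have [jz kz zD] := completions_closer DE zs.
have [crossF nestF] := aD _ _ _ _ _ _ xD yD zD xy yz.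
have zk := completions_lt DE zs.
case/orP=> [/and3P[nxy nyz nxz]|/andP[cy cz]].
  apply: nestF; split; first exact: leq_trans zk kz.
    exact: (must_nestP DE yD zD).
  exact: (must_nestP DE xD yD).
apply: crossF; split; first exact: leq_trans zk kx.
  exact: (must_crossP DE xD yD).
exact: (must_crossP DE yD zD).
Qed.

(* Erdos-Szekeres: five pairwise distinct closing positions contain a monotone
   triple. *)
Lemma completions5 al A s k :
  sorted (fun i j => i < j) s -> size s = 5 -> completions al A s k = set0.
Proof.
case: s => [|a [|b [|c [|d [|e []]]]]] //= /and5P[ab bc cd de _] _.
apply/setP => D; rewrite in_set0; apply/negP => DE.
have aD := avoids3P _ (completions_avoids DE).
have [|ja ka aD'] := completions_closer DE (x := a); first by rewrite !inE eqxx ?orbT.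
have [|jb kb bD] := completions_closer DE (x := b); first by rewrite !inE eqxx ?orbT.
have [|jc kc cD] := completions_closer DE (x := c); first by rewrite !inE eqxx ?orbT.
have [|jd kd dD] := completions_closer DE (x := d); first by rewrite !inE eqxx ?orbT.
have [|je ke eD] := completions_closer DE (x := e); first by rewrite !inE eqxx ?orbT.
have mono x y z jx jy jz : (x, jx) \in D -> (y, jy) \in D -> (z, jz) \in D ->
  x < y -> y < z -> z < k -> k <= jx -> k <= jz -> ~~ (jx < jy < jz) && ~~ (jz < jy < jx).
  move=> xD yD zD xy yz zk kx kz.
  have [crossF nestF] := aD _ _ _ _ _ _ xD yD zD xy yz.
  apply/andP; split; apply/negP => /andP[h1 h2].
    by apply: crossF; split=> //; apply: leq_trans zk kx.
  by apply: nestF; split=> //; apply: leq_trans zk kz.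
have lt x : x \in [:: a; b; c; d; e] -> x < k by move=> xs; exact: (completions_lt DE xs).
have ck : c < k by apply: lt; rewrite !inE eqxx ?orbT.
have dk : d < k by apply: lt; rewrite !inE eqxx ?orbT.
have ek : e < k by apply: lt; rewrite !inE eqxx ?orbT.
have ac := ltn_trans ab bc; have bd := ltn_trans bc cd; have ce := ltn_trans cd de.
have ad := ltn_trans ac cd; have be := ltn_trans bd de; have ae := ltn_trans ad de.
move: (completions_neq DE aD' bD ab) (completions_neq DE bD cD bc).
move: (completions_neq DE cD dD cd) (completions_neq DE dD eD de).
move: (completions_neq DE aD' cD ac) (completions_neq DE bD dD bd) (completions_neq DE cD eD ce).
move: (completions_neq DE aD' dD ad) (completions_neq DE bD eD be) (completions_neq DE aD' eD ae).
move: (mono _ _ _ _ _ _ aD' bD cD ab bc ck ka kc) (mono _ _ _ _ _ _ aD' bD dD ab bd dk ka kd).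
move: (mono _ _ _ _ _ _ aD' bD eD ab be ek ka ke) (mono _ _ _ _ _ _ aD' cD dD ac cd dk ka kd).
move: (mono _ _ _ _ _ _ aD' cD eD ac ce ek ka ke) (mono _ _ _ _ _ _ aD' dD eD ad de ek ka ke).
move: (mono _ _ _ _ _ _ bD cD dD bc cd dk kb kd) (mono _ _ _ _ _ _ bD cD eD bc ce ek kb ke).
move: (mono _ _ _ _ _ _ bD dD eD bd de ek kb ke) (mono _ _ _ _ _ _ cD dD eD cd de ek kc ke).
move: (nat_of_ord ja) (nat_of_ord jb) (nat_of_ord jc) (nat_of_ord jd) (nat_of_ord je).
clear => A B C D E.
(* The ten comparisons fix the relative order of the five right ends; in each order one of the ten
   triples is monotone. *)
by case: (ltngtP A B) => // ?; case: (ltngtP B C) => // ?;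
   case: (ltngtP C D) => // ?; case: (ltngtP D E) => // ?;
   case: (ltngtP A C) => // ?; case: (ltngtP B D) => // ?;
   case: (ltngtP C E) => // ?; case: (ltngtP A D) => // ?;
   case: (ltngtP B E) => // ?; case: (ltngtP A E).
Qed.

(* The reachable states from which completions exist.  A state [(h, (c, n), v)]
   has [h] open arcs x_1 < ... < x_h; [c] lists [must_cross A x_j] for 2 <= j and
   [n] lists [must_nest A x_i x_j] for i < j, lexicographically: at most one
   pair, and an adjacent one, is constrained.  The number of completions is [v]
   times a factor that depends on [h] and the remaining positions only. *)
Definition live_states : seq (nat * (bitseq * bitseq) * nat) :=
  let o := false in let i := true in
  [:: (0, ([::], [::]), 1); (1, ([::], [::]), 1);
      (2, ([:: o], [:: o]), 2); (2, ([:: o], [:: i]), 1); (2, ([:: i], [:: o]), 1);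
      (3, ([:: o; o], [:: o; o; o]), 2); (3, ([:: o; o], [:: i; o; o]), 1);
      (3, ([:: i; o], [:: o; o; o]), 1); (3, ([:: o; o], [:: o; o; i]), 1);
      (4, ([:: o; o; o], [:: o; o; o; o; o; o]), 2);
      (4, ([:: o; o; o], [:: i; o; o; o; o; o]), 1);
      (4, ([:: i; o; o], [:: o; o; o; o; o; o]), 1);
      (4, ([:: o; o; o], [:: o; o; o; i; o; o]), 1)].

Fixpoint nests A s : bitseq :=
  if s is x :: s' then [seq must_nest A x y | y <- s'] ++ nests A s' else [::].

Definition constraints A s : bitseq * bitseq :=
  ([seq must_cross A y | y <- behead s], nests A s).

Definition live A s v : Prop :=
  [/\ diagram A /\ avoids3 A, sorted (fun i j => i < j) s,
      forall i j, (i, j) \in A -> i \notin s, ~~ has (blocked A) s &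
      (size s, constraints A s, v) \in live_states].

Lemma diagram_close A z (k : 'I_m) : diagram A ->
  (forall i j, (i, j) \in A -> j < k) -> (forall j, (z, j) \notin A) -> z < k ->
  diagram ((z, k) |: A).
Proof.
move=> /diagramP[lt injl injr] A_lt zA zk; apply/diagramP; split.
- by move=> i j; rewrite in_setU1 => /predU1P[[-> ->]|/lt].
- move=> i j j'; rewrite !in_setU1 => /predU1P[[iz jk]|ijA] /predU1P[[iz' jk']|ijA'].
  + by rewrite jk jk'.
  + by rewrite iz (negbTE (zA j')) in ijA'.
  + by rewrite iz' (negbTE (zA j)) in ijA.
  + exact: injl ijA ijA'.
- move=> i i' j; rewrite !in_setU1 => /predU1P[[iz jk]|ijA] /predU1P[[iz' jk']|ijA'].
  + by rewrite iz iz'.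
  + by have := A_lt _ _ ijA'; rewrite jk ltnn.
  + by have := A_lt _ _ ijA; rewrite jk' ltnn.
  + exact: injr ijA ijA'.
Qed.

(** The new arc ends last. So in a 3-crossing it would be the one that starts last, in a 3-nesting
    the outermost one, and the two other arcs, lying in [A], would block [z]. *)
Lemma avoids3_close A z (k : 'I_m) : avoids3 A ->
  (forall i j, (i, j) \in A -> j < k) -> ~~ blocked A z -> avoids3 ((z, k) |: A).
Proof.
move=> /avoids3P aA A_lt /negP bz; apply/avoids3P => i i' i'' j j' j''.
have lt x y y' : (x, y) \in (z, k) |: A -> y' = k -> y' < y -> False.
  by rewrite in_setU1 => /predU1P[[_ ->] ->|/A_lt yk ->]; rewrite ?ltnn // ltnNge ltnW.
rewrite !in_setU1 => D1 D2 D3 l1 l2; split=> -[h1 h2 h3].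
- have ijA : (i, j) \in A.
    by case/predU1P: D1 D2 => // -[_ jk]; rewrite -in_setU1 => /lt/(_ jk h2).
  have ijA' : (i', j') \in A.
    by case/predU1P: D2 D3 => // -[_ jk]; rewrite -in_setU1 => /lt/(_ jk h3).
  case/predU1P: D3 => [[e _]|D3]; last by case: (aA _ _ _ _ _ _ ijA ijA' D3 l1 l2) => + _; case.
  apply: bz; apply/exists_inP; exists (i, j) => //; apply/exists_inP; exists (i', j') => //=.
  by rewrite h2 l1 -e l2 h1.
- have ijA'' : (i'', j'') \in A.
    by case/predU1P: D3 D2 => // -[_ jk]; rewrite -in_setU1 => /lt/(_ jk h2).
  have ijA' : (i', j') \in A.
    by case/predU1P: D2 D1 => // -[_ jk]; rewrite -in_setU1 => /lt/(_ jk h3).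
  case/predU1P: D1 => [[e _]|D1]; last by case: (aA _ _ _ _ _ _ D1 ijA' ijA'' l1 l2) => _; case.
  apply: bz; apply/exists_inP; exists (i'', j'') => //; apply/exists_inP; exists (i', j') => //=.
  by rewrite h2 l2 -e l1 orbT.
Qed.

Lemma live_close A s v z (k : 'I_m) v' : live A s v -> z \in s ->
  (forall i j, (i, j) \in A -> j < k) -> (forall x, x \in s -> x < k) ->
  ~~ has (blocked ((z, k) |: A)) (rem z s) ->
  (size (rem z s), constraints ((z, k) |: A) (rem z s), v') \in live_states ->
  live ((z, k) |: A) (rem z s) v'.
Proof.
move=> [[dA aA] ss sA /hasPn bA _] zs A_lt s_lt nb st.
have Us : uniq s by apply: sorted_uniq ss => [x y t /ltn_trans|x]; [exact | exact: ltnn].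
split=> //.
- split; last exact: avoids3_close (bA _ zs).
  apply: diagram_close (s_lt _ zs) => // j; apply/negP => /sA; by rewrite zs.
- by apply: subseq_sorted ss; [move=> x y t /ltn_trans; exact | exact: rem_subseq].
move=> i j; rewrite in_setU1 mem_rem_uniq // inE => /predU1P[[-> _]|/sA/negbTE ->].
  by rewrite eqxx.
by rewrite andbF.
Qed.

(** All arcs of [A] end at or before [k], so no constraint involves the new arc. The value changes
    only when a second arc is opened: it then doubles, which is the factor [visit 2]. The bound
    [j <= k] is weak because [k] may just have closed an arc. *)
Lemma live_push A s v (k : 'I_m) : live A s v -> size s < 4 ->
  (forall i j, (i, j) \in A -> j <= k) -> (forall x, x \in s -> x < k) ->
  live A (rcons s k) (v * visit (size s).+1).
Proof.
move=> [[dA aA] ss sA bA st] s4 A_le s_lt.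
have [A_lt _ _] := diagramP _ dA.
have bk : blocked A k = false.
  apply/negbTE/negP => /exists_inP[[i j] /= pA /exists_inP[[i' j'] /= qA]].
  case/andP=> _ /orP[/and3P[_ _]|/andP[+ _]].
    by rewrite ltnNge (A_le _ _ pA).
  by rewrite ltnNge (leq_trans (ltnW (A_lt _ _ qA)) (A_le _ _ qA)).
have nk x : must_nest A x k = false.
  by apply/negbTE/negP => /exists_inP[[i j] /= /A_le pA /andP[_]]; rewrite ltnNge pA.
have ck : must_cross A k = false.
  apply/negbTE/negP => /exists_inP[[i j] /= pA]; rewrite ltnNge.
  by rewrite (leq_trans (ltnW (A_lt _ _ pA)) (A_le _ _ pA)).
split=> //.
- case: s ss s_lt {sA bA st s4} => //= x s ss s_lt; rewrite rcons_path ss /=.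
  by apply: s_lt; exact: mem_last.
- move=> i j ijA; rewrite mem_rcons inE negb_or (sA _ _ ijA) andbT.
  apply/eqP => ik; have := A_lt _ _ ijA; rewrite ik ltnNge (A_le _ _ ijA) //.
- by rewrite has_rcons bk.
case: s s4 {ss sA bA s_lt} st => [|a [|b [|c [|d s]]]] //= _;
  rewrite /constraints /= ?nk ?ck !inE; do ?case/orP; move/eqP=> [*]; subst=> //=.
all: by repeat match goal with H : ?b = _ |- context [?b] => rewrite H end.
Qed.

Ltac rewrite_hyps :=
  repeat match goal with H : ?b = _ |- context [?b] => rewrite H end.

Lemma ord_lt x y : x < y ->
  ((x < y) = true) * ((y < x) = false) * ((x == y) = false) * ((y == x) = false).
Proof.
by move=> xy; rewrite [x < y]xy -!(inj_eq val_inj) /= eq_sym (gtn_eqF xy) ltnNge ltnW.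
Qed.

(** All listed values are positive, so the default 0 marks a state that is not listed. *)
Definition state_value (hc : nat * (bitseq * bitseq)) : nat :=
  head 0 [seq st.2 | st <- live_states & st.1 == hc].

Lemma state_value_live hc : state_value hc != 0 -> (hc, state_value hc) \in live_states.
Proof.
rewrite /state_value; case E: [seq _ | _ <- _ & _] => [//|v vs] /= _.
have : v \in [seq st.2 | st <- live_states & st.1 == hc] by rewrite E inE eqxx.
by case/mapP=> -[hc' v']; rewrite mem_filter => /andP[/= /eqP-> +] ->.
Qed.

(** The heart of the count: over all choices of the arc to close, the values of the resulting
    states, dead ones counting 0, add up to [v * visit (size s).-1]. For example, with three
    unconstrained arcs the values are 1, 2, 1, with sum 2 * 2; with four they are 0, 1, 1, 0, with
    sum 2. The function [f] is abstract so that the same identity serves with and without a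
    subsequent opening at [k]. *)
Lemma sum_close A s v (k : 'I_m) (f : {set 'I_m * 'I_m} -> seq 'I_m -> nat) u :
  live A s v ->
  (forall i j, (i, j) \in A -> j < k) -> (forall x, x \in s -> x < k) ->
  (forall z v', live ((z, k) |: A) (rem z s) v' -> z \in s ->
     f ((z, k) |: A) (rem z s) = v' * u) ->
  (forall z, dead ((z, k) |: A) (rem z s) -> f ((z, k) |: A) (rem z s) = 0) ->
  \sum_(z <- s) f ((z, k) |: A) (rem z s) = (0 < size s) * (v * visit (size s).-1 * u).
Proof.
move=> lA A_lt s_lt f_live f_dead.
(* The condition on [v'] says that the state reached is dead or listed; in each case below it is
   settled by computation. *)
have fE z : z \in s ->
    let A' := (z, k) |: A in let s' := rem z s in
    let v' := state_value (size s', constraints A' s') in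
    dead A' s' || (v' != 0) -> f A' s' = (if dead A' s' then 0 else v') * u.
  move=> zs /=; case: ifP => [/f_dead-> //|/norP[nb _] /= st].
  apply: f_live => //; exact: live_close lA zs A_lt s_lt nb (state_value_live st).
have [_ ss _ nb st] := lA; have {}nb z : z \in s -> blocked A z = false.
  by move/(hasPn nb)/negbTE.
move: {f_live f_dead lA} ss nb st fE s_lt.
case: s => [|a [|b [|c [|d [|e s]]]]].
- by rewrite big_nil.
- move=> _ nb st fE _; rewrite big_seq1; have ba := nb a (mem_head _ _).
  rewrite fE ?mem_head //= ?eqxx // /dead /=.
  by move: st; rewrite /live_states /constraints !inE /=; do ?case/orP;
    move/eqP=> // -[->]; rewrite /state_value /= !mul1n.
- move=> /= /andP[ab _]; have L := ord_lt ab.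
  rewrite !big_cons big_nil => bF st fE s_lt.
  have na : blocked A a = false by apply: bF; rewrite !inE eqxx ?orbT.
  have ak : a < k by apply: s_lt; rewrite !inE eqxx ?orbT.
  have nb : blocked A b = false by apply: bF; rewrite !inE eqxx ?orbT.
  have bk : b < k by apply: s_lt; rewrite !inE eqxx ?orbT.
  (* The order of the left ends and the entries of the listed state turn all constraints after the
     closing into constants, so each listed state is checked by evaluation. Three and four open arcs
     are treated in the same way. *)
  rewrite !fE ?inE ?eqxx ?orbT //; move: st;
    rewrite /= ?L ?eqxx /= /dead /constraints /live_states !inE /=;
    rewrite ?(blocked_close _ _ A_lt) ?na ?nb ?ltnn ?L /=
      ?must_nest_close ?must_cross_close ?L //= /state_value;
    do ?case/orP; move/eqP=> // -[*]; rewrite_hyps => //=; ring.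
- move=> /= /and3P[ab bc _]; have L := (ord_lt ab, ord_lt bc, ord_lt (ltn_trans ab bc)).
  rewrite !big_cons big_nil => bF st fE s_lt.
  have na : blocked A a = false by apply: bF; rewrite !inE eqxx ?orbT.
  have ak : a < k by apply: s_lt; rewrite !inE eqxx ?orbT.
  have nb : blocked A b = false by apply: bF; rewrite !inE eqxx ?orbT.
  have bk : b < k by apply: s_lt; rewrite !inE eqxx ?orbT.
  have nc : blocked A c = false by apply: bF; rewrite !inE eqxx ?orbT.
  have ck : c < k by apply: s_lt; rewrite !inE eqxx ?orbT.
  rewrite !fE ?inE ?eqxx ?orbT //; move: st;
    rewrite /= ?L ?eqxx /= /dead /constraints /live_states !inE /=;
    rewrite ?(blocked_close _ _ A_lt) ?na ?nb ?nc ?ltnn ?L /=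
      ?must_nest_close ?must_cross_close ?L //= /state_value;
    do ?case/orP; move/eqP=> // -[*]; rewrite_hyps => //=; ring.
- move=> /= /and4P[ab bc cd _]; have ac := ltn_trans ab bc; have bd := ltn_trans bc cd.
  have L := (ord_lt ab, ord_lt bc, ord_lt cd, ord_lt ac, ord_lt bd, ord_lt (ltn_trans ab bd)).
  rewrite !big_cons big_nil => bF st fE s_lt.
  have na : blocked A a = false by apply: bF; rewrite !inE eqxx ?orbT.
  have ak : a < k by apply: s_lt; rewrite !inE eqxx ?orbT.
  have nb : blocked A b = false by apply: bF; rewrite !inE eqxx ?orbT.
  have bk : b < k by apply: s_lt; rewrite !inE eqxx ?orbT.
  have nc : blocked A c = false by apply: bF; rewrite !inE eqxx ?orbT.
  have ck : c < k by apply: s_lt; rewrite !inE eqxx ?orbT.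
  have nd : blocked A d = false by apply: bF; rewrite !inE eqxx ?orbT.
  have dk : d < k by apply: s_lt; rewrite !inE eqxx ?orbT.
  rewrite !fE ?inE ?eqxx ?orbT //; move: st;
    rewrite /= ?L ?eqxx /= /dead /constraints /live_states !inE /=;
    rewrite ?(blocked_close _ _ A_lt) ?na ?nb ?nc ?nd ?ltnn ?L /=
      ?must_nest_close ?must_cross_close ?L //= /state_value;
    do ?case/orP; move/eqP=> // -[*]; rewrite_hyps => //=; ring.
- by [].
Qed.

Lemma card_completions_end al A s v : live A s v -> #|completions al A s m| = v * (size s == 0).
Proof.
move=> [[dA aA] _ _ _ st]; case: s st => [|x s] st.
  have -> : v = 1 by move: st; rewrite /live_states !inE /=; do ?case/orP; move/eqP=> // -[].
  rewrite /= mul1n -(cards1 A); apply: eq_card => D; rewrite in_set1.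
  apply/completionsP/eqP => [[_ _ AE _]|->].
    by apply/setP => -[i j]; rewrite AE ltn_ord andbT.
  split=> // [|i j|i]; last by split=> // -[_ [j]]; rewrite leqNgt ltn_ord.
    by apply/forallP => i; rewrite leqNgt ltn_ord.
  by rewrite ltn_ord andbT.
rewrite muln0; apply: eq_card0 => D; apply/negP => DE.
by have [j] := completions_closer DE (mem_head x s); rewrite leqNgt ltn_ord.
Qed.

Lemma live_size A s v : live A s v -> size s <= 4.
Proof.
by case=> _ _ _ _; rewrite /live_states !inE; do ?case/orP; move/eqP=> // -[-> *].
Qed.

Lemma push_dead A s o (k : 'I_m) : dead A s -> dead A (push o k s).
Proof.
have sub x : x \in s -> x \in push o k s by rewrite mem_push => ->; rewrite orbT.
case/or3P=> [/hasP[y ys by_]|/hasP[x xs /hasP[y ys H]]|/hasP[x xs /hasP[y ys /hasP[z zs H]]]].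
- by apply/or3P; apply: Or31; apply/hasP; exists y; rewrite ?sub.
- by apply/or3P; apply: Or32; apply/hasP; exists x; rewrite ?sub //; apply/hasP; exists y; rewrite ?sub.
apply/or3P; apply: Or33; apply/hasP; exists x; rewrite ?sub //; apply/hasP; exists y; rewrite ?sub //.
by apply/hasP; exists z; rewrite ?sub.
Qed.

(** Induction on the number of remaining positions. At each one [sum_close] handles the closing, and
    [half] the opening that may follow it. *)
Lemma card_completions al A s k v : size al = m -> k <= m -> live A s v ->
  (forall i j, (i, j) \in A -> j < k) -> (forall x, x \in s -> x < k) ->
  #|completions al A s k| = v * weight (size s) (drop k al).
Proof.
move=> al_m; have [n] := ubnP (m - k); elim: n k A s v => // n IHn k A s v.
rewrite ltnS => mkn; rewrite leq_eqVlt => /predU1P[->|km] lA A_lt s_lt.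
  by rewrite drop_oversize ?al_m // (card_completions_end _ lA).
have {}IHn := IHn k.+1 _ _ _ _ km; rewrite -[k]/(nat_of_ord (Ordinal km)) in A_lt s_lt *.
set k' := Ordinal km in A_lt s_lt *.
have kn : m - k.+1 < n by apply: leq_trans mkn; rewrite ltn_sub2l.
have half A' s' v' o : live A' s' v' -> (forall i j, (i, j) \in A' -> j <= k') ->
    (forall x, x \in s' -> x < k') ->
    #|completions al A' (push o k' s') k.+1| =
      v' * ((if o then visit (size s').+1 else 1) * weight (size s' + o) (drop k.+1 al)).
  move=> lA' A_lt' s_lt'; case: o; last first.
    by rewrite mul1n addn0 (IHn _ _ v') // => x /s_lt'/ltnW.
  have := live_size lA'; rewrite leq_eqVlt => /predU1P[s4|s4].
    (* A fifth open arc leaves no completions, in agreement with [visit 5 = 0]. *)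
    rewrite s4 mul0n muln0 completions5 ?cards0 ?size_rcons ?s4 //.
    case: lA' => _ ss _ _ _; case: s' ss s_lt' {s4} => //= x s' ss s_lt'.
    by rewrite rcons_path ss s_lt' ?mem_last.
  rewrite (IHn _ _ _ kn (live_push lA' s4 A_lt' s_lt')) //.
    by rewrite size_rcons addn1 mulnA.
  by move=> x; rewrite mem_rcons inE => /predU1P[->//|/s_lt'/ltnW].
have [_ ss _ _ _] := lA.
have Us : uniq s by apply: sorted_uniq ss => [x y t /ltn_trans|x]; [exact | exact: ltnn].
rewrite (card_completions_step al Us s_lt A_lt) (drop_nth xpred0) ?al_m //= big_distrr.
apply: eq_bigr => -[[] o] _ /=; last first.
  by rewrite !mul1n subn0 (half _ _ _ _ lA) // => i j /A_lt/ltnW.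
rewrite (@sum_close A s v k' (fun A' s' => #|completions al A' (push o k' s') k.+1|)
  ((if o then visit (size s - 1).+1 else 1) * weight (size s - 1 + o) (drop k.+1 al))) //.
- by rewrite -!mulnA mulnCA.
- move=> z v' lA' zs; have := half _ _ _ o lA'; rewrite size_rem // subn1; apply.
    by move=> i j; rewrite in_setU1 => /predU1P[[_ ->]//|/A_lt/ltnW].
  by move=> x /mem_rem/s_lt.
by move=> z dA; rewrite completions_dead ?cards0 //; apply: push_dead.
Qed.

Definition patternless al : {set {set 'I_m * 'I_m}} :=
  [set D | [&& diagram D, avoids3 D & [forall i : 'I_m, nth xpred0 al i (pos_type D i)]]].

Theorem card_patternless al : size al = m -> #|patternless al| = weight 0 al.
Proof.
move=> al_m; rewrite -[al in RHS]drop0 -[weight _ _]mul1n -(@card_completions al set0 [::] 0 1) //.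
- apply: eq_card => D; rewrite !inE; congr [&& _, _ & _].
  rewrite /allowed; set b := (X in _ = [&& _, X & _]); set c := (X in _ = [&& _, _ & X]).
  have -> : b = true by apply/eqP/setP => i; rewrite !inE andbF.
  have -> : c = true by apply/forallP.
  by rewrite !andbT; apply: eq_forallb => i; rewrite leq0n.
- split=> //.
    split; first by apply/diagramP; split=> [i j|i j j'|i i' j]; rewrite inE.
    by apply/avoids3P => i i' i'' j j' j''; rewrite inE.
- by move=> i j; rewrite inE.
Qed.

End Diagrams.

(** * Matchings and partitions as diagrams *)

Section Patterns.

Variable m : nat.
Implicit Types (A D : {set 'I_m * 'I_m}) (i j x y z : 'I_m).

Lemma tnth_increasing n (t : n.-tuple 'I_m) : sorted (fun i j => i < j) t ->
  {homo tnth t : x y / x < y}.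
Proof.
move=> st x y xy; have [i0 _] : exists i0 : 'I_m, true by exists (tnth t x).
rewrite !(tnth_nth i0).
by apply: (sorted_ltn_nth (leT := fun i j : 'I_m => i < j)) st _ _ _ _ xy;
  rewrite ?inE ?size_tuple // => a b c /ltn_trans; apply.
Qed.

Lemma contains_patternP k A (tau : 'S_k) :
  reflect (exists2 i : 'I_(k + k) -> 'I_m, {homo i : x y / x < y} &
             forall a : 'I_k, (i (lshift k a), i (rev_ord (lshift k (tau a)))) \in A)
          (contains_pattern A tau).
Proof.
apply: (iffP existsP) => [[i /andP[/forallP incr /forallP iA]]|[i incr iA]].
  by exists i => // x y xy; have /forallP/(_ y)/implyP := incr x; apply.
exists [ffun x => i x]; apply/andP; split; last by apply/forallP => a; rewrite !ffunE.
by apply/forallP => x; apply/forallP => y; apply/implyP => xy; rewrite !ffunE incr.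
Qed.

Lemma avoids3E A : avoids3 A = avoids A pat123 && avoids A pat321.
Proof.
apply/avoids3P/andP => [av|[/contains_patternP av1 /contains_patternP av2]].
  split; apply/contains_patternP => -[i incr iA].
    have D a := iA a; rewrite /pat123 in D.
    have lt a b (a6 : a < 3 + 3) (b6 : b < 3 + 3) : a < b -> i (Ordinal a6) < i (Ordinal b6).
      by move=> ab; apply: incr.
    (* The identity pairs position a with its mirror image 5 - a. *)
    have E a b (a6 : a < 3 + 3) (b6 : b < 3 + 3) (a3 : a < 3) :
        b = 5 - a -> (i (Ordinal a6), i (Ordinal b6)) \in A.
      move=> ab; have := D (Ordinal a3); rewrite perm1.
      by congr ((i _, i _) \in A); apply: val_inj => //=; rewrite ab; lia.
    have [] // := av _ _ _ _ _ _ (E 0 5 isT isT isT erefl)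
      (E 1 4 isT isT isT erefl) (E 2 3 isT isT isT erefl).
    - exact: lt.
    - exact: lt.
    by move=> _; case; split; exact: lt.
  have D a := iA a; rewrite /pat321 in D.
  have lt a b (a6 : a < 3 + 3) (b6 : b < 3 + 3) : a < b -> i (Ordinal a6) < i (Ordinal b6).
    by move=> ab; apply: incr.
  (* Here two reversals are composed: a is paired with 5 - (2 - a) = 3 + a. *)
  have E a b (a6 : a < 3 + 3) (b6 : b < 3 + 3) (a3 : a < 3) :
      b = 3 + a -> (i (Ordinal a6), i (Ordinal b6)) \in A.
    move=> ab; have := D (Ordinal a3); rewrite permE.
    by congr ((i _, i _) \in A); apply: val_inj => //=; rewrite ab; lia.
  have [] // := av _ _ _ _ _ _ (E 0 3 isT isT isT erefl)
      (E 1 4 isT isT isT erefl) (E 2 5 isT isT isT erefl).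
  - exact: lt.
  - exact: lt.
  by case; split; exact: lt.
move=> i i' i'' j j' j'' D1 D2 D3 l1 l2; split=> -[h1 h2 h3].
  apply: av2; pose t : (3 + 3).-tuple 'I_m := [tuple i; i'; i''; j; j'; j''].
  exists (tnth t); first by apply: tnth_increasing; rewrite /= l1 l2 h1 h2 h3.
  by case=> -[|[|[|//]]] a3; rewrite permE !(tnth_nth i) /=.
apply: av1; pose t : (3 + 3).-tuple 'I_m := [tuple i; i'; i''; j''; j'; j].
exists (tnth t); first by apply: tnth_increasing; rewrite /= l1 l2 h1 h2 h3.
by case=> -[|[|[|//]]] a3; rewrite perm1 !(tnth_nth i) /=.
Qed.

End Patterns.

(** * Perfect matchings *)

Section PerfectMatchings.

Variable m : nat.
Implicit Types (D : {set 'I_m * 'I_m}).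

Lemma card_openers D : diagram D -> #|[set i | (pos_type D i).2]| = #|D|.
Proof.
move=> /diagramP[_ injl _]; rewrite -(card_in_imset (f := fst)) => [|[i j] [i' j'] ijD + /= ii'].
  apply: eq_card => i; rewrite inE; apply/existsP/imsetP => [[j ijD]|[[i' j] ijD ->]].
    by exists (i, j).
  by exists j.
by rewrite -ii' => ijD'; rewrite (injl _ _ _ ijD ijD').
Qed.

Lemma card_closers D : diagram D -> #|[set i | (pos_type D i).1]| = #|D|.
Proof.
move=> /diagramP[_ _ injr]; rewrite -(card_in_imset (f := snd)) => [|[i j] [i' j'] ijD + /= jj'].
  apply: eq_card => i; rewrite inE; apply/existsP/imsetP => [[j ijD]|[[i' j] ijD ->]].
    by exists (j, i).
  by exists i'.
by rewrite -jj' => ijD'; rewrite (injr _ _ _ ijD ijD').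
Qed.

End PerfectMatchings.

(** A diagram has as many openers as closers as arcs. With n disjoint arcs these are two disjoint
    sets of size n, which exhaust the 2n positions; conversely, if they partition the positions,
    there are n arcs. *)
Lemma perfect_matchingE n (M : {set 'I_(2 * n) * 'I_(2 * n)}) :
  perfect_matching M =
  diagram M && [forall i, (pos_type M i).1 (+) (pos_type M i).2].
Proof.
apply/and3P/andP => [[/eqP cM /forall_inP lt /forall_inP disj]|[dM /forallP xorM]].
  have {}disj p q x : p \in M -> q \in M -> x \in [set p.1; p.2] -> x \in [set q.1; q.2] -> p = q.
    move=> pM qM xp xq; apply/eqP; apply: contraT => pq.
    have /forall_inP/(_ q qM)/implyP/(_ pq)/disjointFr/(_ xp) := disj _ pM.
    by rewrite xq.
  have dM : diagram M.
    apply/diagramP; split=> [i j /lt //|i j j' ijM ijM'|i i' j ijM ijM'].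
      by have [] : (i, j) = (i, j') by apply: (disj _ _ i); rewrite ?inE ?eqxx.
    by have [] : (i, j) = (i', j) by apply: (disj _ _ j); rewrite ?inE ?eqxx ?orbT.
  split=> //.
  have CO : [set i | (pos_type M i).1] = ~: [set i | (pos_type M i).2].
    apply/eqP; rewrite eqEcard; apply/andP; split; last first.
      have := cardsC [set i | (pos_type M i).2].
      by rewrite card_openers // card_closers // card_ord; lia.
    apply/subsetP => i; rewrite !inE.
    case/existsP=> j jiM; apply/negP => /existsP[l ilM].
    have [ji il] : (j, i) = (i, l) by apply: (disj _ _ i); rewrite ?inE ?eqxx ?orbT.
    by have := lt _ jiM; rewrite /= ji ltnn.
  by apply/forallP => i; have := in_setC i [set i | (pos_type M i).2];
    rewrite -CO !in_set => ->; case: (_.2).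
have [lt injl injr] := diagramP _ dM.
split; last 1 first.
- apply/forall_inP => -[i j] ijM; apply/forall_inP => -[i' j'] ijM' /=; apply/implyP => pq.
  have ncl x y z : (x, y) \in M -> (z, x) \notin M.
    move=> xyM; apply/negP => zxM; have := xorM x.
    by rewrite /= (introT existsP) ?(introT existsP) //; [exists y | exists z].
  rewrite disjoints_subset; apply/subsetP => x; rewrite !inE negb_or.
  case/orP=> /eqP->; apply/andP; split; apply/eqP => e; subst.
  + by rewrite (injl _ _ _ ijM ijM') eqxx in pq.
  + by have := ncl _ _ i' ijM; rewrite ijM'.
  + by have := ncl _ _ i ijM'; rewrite ijM.
  + by rewrite (injr _ _ _ ijM ijM') eqxx in pq.
- have CO : [set i | (pos_type M i).1] = ~: [set i | (pos_type M i).2].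
    by apply/setP => i; rewrite !inE; have := xorM i => /=; case: [exists _, _]; case: [exists _, _].
  have := cardsC [set i | (pos_type M i).2].
  by rewrite -CO card_openers // card_closers // card_ord => H; apply/eqP; lia.
by apply/forall_inP => -[i j] /lt.
Qed.

Lemma matchingsE n :
  matchings n pat123 pat321 = patternless (2 * n) (nseq (2 * n) (fun co => co.1 (+) co.2)).
Proof.
apply/setP => M; rewrite !inE perfect_matchingE avoids3E.
under [in RHS]eq_forallb => i do rewrite nth_nseq ltn_ord.
by case: (diagram M); case: (avoids M pat123); case: (avoids M pat321); rewrite /= ?andbT ?andbF.
Qed.

Lemma matchings_of_shapeE n F : dyck_board n F -> size (border F) = 2 * n ->
  matchings_of_shape n F pat123 pat321 =
  patternless (2 * n) [seq (fun co => co == (~~ b, b)) | b <- border F].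
Proof.
move=> dF size_F; apply/setP => M; rewrite !inE perfect_matchingE avoids3E /has_shape dF /=.
have nthM (i : 'I_(2 * n)) : nth south (matching_word M) i = (pos_type M i).2.
  rewrite (nth_map i) ?size_enum_ord // nth_ord_enum /opener.
  by rewrite /=; case: [exists _, _].
have sizeM : size (matching_word M) = 2 * n by rewrite size_map size_enum_ord.
have -> : [forall i : 'I_(2 * n),
             nth xpred0 [seq (fun co => co == (~~ b, b)) | b <- border F] i (pos_type M i)] =
    [forall i, (pos_type M i).1 (+) (pos_type M i).2] && (border F == matching_word M).
  apply/forallP/andP => [H|[/forallP xorM /eqP FM] i].
    have {}H (i : 'I_(2 * n)) : pos_type M i = (~~ nth south (border F) i, nth south (border F) i).
      by have := H i; rewrite (nth_map south) ?size_F //= => /eqP.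
    split; first by apply/forallP => i; rewrite H /=; case: nth.
    apply/eqP/(@eq_from_nth _ south); rewrite ?size_F ?sizeM // => i i_lt.
    by rewrite (nthM (Ordinal i_lt)) H.
  rewrite (nth_map south) ?size_F //= FM nthM.
  by have := xorM i; case: (pos_type M i) => [[] []].
by case: (diagram M); case: (avoids M pat123); case: (avoids M pat321); rewrite /= ?andbT ?andbF.
Qed.

(** Two paths from the same point along a functional relation agree step by step, so one is a prefix
    of the other. *)
Lemma connect_comparable (T : finType) (e : rel T) :
  (forall x y y', e x y -> e x y' -> y = y') ->
  forall x y z, connect e x y -> connect e x z -> connect e y z || connect e z y.
Proof.
move=> fun_e x y z /connectP[p ep ->] /connectP[q eq ->] {y z}.
elim: p x q ep eq => [|x1 p IHp] x [|x2 q] /=.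
- by rewrite connect0.
- by move=> _ eq; apply/orP; left; apply/connectP; exists (x2 :: q).
- by move=> ep _; apply/orP; right; apply/connectP; exists (x1 :: p).
move=> /andP[ex1 ep] /andP[ex2 eq].
by rewrite (fun_e _ _ _ ex1 ex2) in ep *; exact: IHp.
Qed.

(** * Set partitions as chains of arcs *)

Section Chains.

Variable n : nat.
Implicit Types (D : {set 'I_n * 'I_n}) (x y z : 'I_n) (P Q : {set {set 'I_n}}).

Definition arc_rel D x y : bool := (x, y) \in D.

(** The blocks are recovered from the arcs as classes of this relation: in a diagram the connected
    components are directed paths, so one of any two points in a component reaches the other. *)
Definition linked D x y : bool :=
  connect (arc_rel D) x y || connect (arc_rel D) y x.

Lemma connect_arc_leq D x y : diagram D -> connect (arc_rel D) x y -> x <= y.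
Proof.
move=> /diagramP[lt _ _] /connectP[p + ->]; elim: p x => //= z p IHp x /andP[/lt xz /IHp].
exact: leq_trans (ltnW xz).
Qed.

Lemma connect_arc_ltn D x y : connect (arc_rel D) x y -> x < y ->
  exists2 z, (x, z) \in D & connect (arc_rel D) z y.
Proof.
case/connectP=> -[|z p] /=; first by move=> _ ->; rewrite ltnn.
by case/andP=> xz ep -> _; exists z => //; apply/connectP; exists p.
Qed.

Lemma linked_equiv D : diagram D -> {in [set: 'I_n] & &, equivalence_rel (linked D)}.
Proof.
move=> /diagramP[_ injl injr] x y z _ _ _; split=> [|xy]; first by rewrite /linked connect0.
have trans : forall x y z, linked D x y -> linked D y z -> linked D x z.
  move=> {xy}x {}y {}z /orP[xy|yx] /orP[yz|zy].
  - by rewrite /linked (connect_trans xy yz).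
  (* Both paths end at [y]. Each position closes at most one arc, so the reversed relation is
     functional and [connect_comparable] applies to it. *)
  - have rev a b : connect (fun u v => arc_rel D v u) a b = connect (arc_rel D) b a.
      exact: (connect_rev (arc_rel D) a b).
    rewrite /linked orbC -!rev; apply: (@connect_comparable _ _ _ y); rewrite ?rev //.
    by move=> a b c; exact: injr.
  - by apply: (connect_comparable _ yx yz) => a b c; exact: injl.
  - by rewrite /linked (connect_trans zy yx) orbT.
apply/idP/idP; last exact: trans.
by apply: trans; rewrite /linked orbC.
Qed.

Section Arcs.

Variable P : {set {set 'I_n}}.
Hypothesis partP : partition P [set: 'I_n].

Lemma mem_pblockT x : x \in pblock P x.
Proof. by rewrite mem_pblock (cover_partition partP) inE. Qed.

Lemma pblock_in x : pblock P x \in P.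
Proof. by rewrite pblock_mem // (cover_partition partP) inE. Qed.

Lemma pblockE B x : B \in P -> x \in B -> pblock P x = B.
Proof. by case/and3P: partP => _ triv _; exact: def_pblock. Qed.

Lemma pblock_eq x y : y \in pblock P x -> pblock P y = pblock P x.
Proof. by apply: pblockE; exact: pblock_in. Qed.

Lemma arcsP x y :
  reflect [/\ x < y, y \in pblock P x & forall z, z \in pblock P x -> ~~ (x < z < y)]
          ((x, y) \in arcs P).
Proof.
rewrite inE; apply: (iffP exists_inP) => [[B BP /and4P[/= xB yB xy /forall_inP xzy]]|[xy yx H]].
  by rewrite (pblockE BP xB).
exists (pblock P x); first exact: pblock_in.
by rewrite mem_pblockT yx xy; apply/forall_inP.
Qed.

Lemma diagram_arcs : diagram (arcs P).
Proof.
apply/diagramP; split=> [x y /arcsP[]//|x y y' /arcsP[xy yx H] /arcsP[xy' yx' H']|].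
  by have [yy'|yy'|/val_inj//] := ltngtP y y';
    [have := H' _ yx | have := H _ yx']; rewrite ?xy ?xy' ?yy'.
move=> x x' y /arcsP[xy yx H] /arcsP[xy' yx' H'].
have xx' : pblock P x = pblock P x' by rewrite -(pblock_eq yx) (pblock_eq yx').
have [lt|lt|/val_inj//] := ltngtP x x'.
  by have := H x'; rewrite xx' mem_pblockT lt xy' => /(_ isT).
by have := H' x; rewrite -xx' mem_pblockT lt xy => /(_ isT).
Qed.

Lemma linked_arcs x y : linked (arcs P) x y = (y \in pblock P x).
Proof.
have down a b : connect (arc_rel (arcs P)) a b -> b \in pblock P a.
  case/connectP=> p + ->; elim: p a => [|c p IHp] a /=; first by rewrite mem_pblockT.
  by case/andP=> /arcsP[_ ca _] /IHp; rewrite (pblock_eq ca).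
have up (a b : 'I_n) : a <= b -> b \in pblock P a -> connect (arc_rel (arcs P)) a b.
  have [k] := ubnP (b - a); elim: k a => // k IHk a; rewrite ltnS => bak.
  rewrite leq_eqVlt => /predU1P[/val_inj->//|ab ba].
  (* The point [c] is the successor of [a] in its block, so that [(a, c)] is an arc. *)
  have [c /andP[ca ac] min] := @arg_minnP _ b (fun c => (c \in pblock P a) && (a < c)) val
    (introT andP (conj ba ab)).
  have cb : c <= b by apply: min; rewrite ba.
  apply: connect_trans (IHk c _ cb _).
  - apply: connect1; apply/arcsP; split=> // z za; apply/negP => /andP[az zc].
    by have := min z; rewrite za az leqNgt zc => /(_ isT).
  - by apply: leq_trans bak; apply: ltn_sub2l.
  - by rewrite (pblock_eq ca).
apply/orP/idP => [[/down//|/down yx]|yx].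
  by rewrite (pblock_eq yx) mem_pblockT.
have [le|/ltnW le] := leqP x y; first by left; exact: up.
by right; apply: up => //; rewrite (pblock_eq yx) mem_pblockT.
Qed.

End Arcs.

Lemma arcs_inj P Q : partition P [set: 'I_n] -> partition Q [set: 'I_n] ->
  arcs P = arcs Q -> P = Q.
Proof.
move=> pP pQ PQ.
have same x : pblock P x = pblock Q x.
  by apply/setP => y; rewrite -!linked_arcs // PQ.
suff sub P' Q' : partition P' [set: 'I_n] -> partition Q' [set: 'I_n] ->
    pblock P' =1 pblock Q' -> P' \subset Q'.
  by apply/eqP; rewrite eqEsubset !sub // => x; rewrite same.
move=> pP' pQ' same'; apply/subsetP => B BP.
have /set0Pn[x xB] : B != set0 by apply: contraTneq BP => ->; case/and3P: pP'.
by rewrite -(pblockE pP' BP xB) same' pblock_in.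
Qed.

(** The classes of [linked] serve as blocks. An arc of [D] joins neighbours of a block, because a
    path from [x] to a larger point has to begin with the only arc that starts at [x]. *)
Lemma arcs_surj D : diagram D ->
  exists2 P, partition P [set: 'I_n] & arcs P = D.
Proof.
move=> dD; have eqD := linked_equiv dD; have [lt injl _] := diagramP _ dD.
have pP := equivalence_partitionP eqD; set P := equivalence_partition _ _ in pP.
have inP x y : (y \in pblock P x) = linked D x y.
  by rewrite pblock_equivalence_partition ?inE.
exists P => //; apply/setP => -[x y]; apply/(arcsP pP)/idP.
  case=> xy; rewrite inP => /orP[|/(connect_arc_leq dD)]; last by rewrite leqNgt xy.
  move=> cxy H; have [z xz zy] := connect_arc_ltn cxy xy.
  have := H z; rewrite inP /linked (connect1 (xz : arc_rel D x z)) lt //= => /(_ isT).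
  have := connect_arc_leq dD zy; rewrite leq_eqVlt => /predU1P[/val_inj<-//|->] //.
move=> xyD; split; first exact: lt.
  by rewrite inP /linked connect1.
move=> z; rewrite inP => /orP[xz|/(connect_arc_leq dD) zx]; last first.
  by rewrite ltnNge zx.
apply/negP => /andP[xz_lt zy]; have [y' xy' y'z] := connect_arc_ltn xz xz_lt.
have := connect_arc_leq dD y'z; by rewrite (injl _ _ _ xy' xyD) leqNgt zy.
Qed.

Lemma card_partitions :
  #|partitions n pat123 pat321| = #|patternless n (nseq n xpredT)|.
Proof.
rewrite -(card_in_imset (f := @arcs n)) => [|P Q]; last first.
  by rewrite !inE => /andP[pP _] /andP[pQ _]; exact: arcs_inj.
apply: eq_card => D; rewrite inE.
have -> : [forall i : 'I_n, nth xpred0 (nseq n xpredT) i (pos_type D i)] = true.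
  by apply/forallP => i; rewrite nth_nseq ltn_ord.
rewrite avoids3E andbT; apply/imsetP/andP => [[P]|[dD aD]].
  by rewrite inE => /andP[pP aP] ->; rewrite diagram_arcs.
by have [P pP PD] := arcs_surj dD; exists P; rewrite // inE pP PD.
Qed.

End Chains.

(** * Generating functions *)

Lemma sum_bool2 (F : bool * bool -> nat) :
  \sum_co F co = F (true, true) + F (true, false) + F (false, true) + F (false, false).
Proof.
rewrite (eq_bigr (fun co => F (co.1, co.2))) => [|[] //].
by rewrite -(pair_bigA _ (fun c o => F (c, o))) !big_bool /= !addnA.
Qed.

Lemma weightS h (a : pred (bool * bool)) al :
  weight h (a :: al) =
    a (true, true) * ((0 < h) * visit h.-1 * visit h.-1.+1 * weight h.-1.+1 al) +
    a (true, false) * ((0 < h) * visit h.-1 * weight h.-1 al) +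
    a (false, true) * (visit h.+1 * weight h.+1 al) + a (false, false) * weight h al.
Proof.
by rewrite /= big_mkcond sum_bool2 /= !addn1 !addn0 !subn0 subn1 !mul1n !muln1;
  do 4!case: (a _); rewrite ?mul1n ?mul0n.
Qed.

Definition opener_or_closer (co : bool * bool) : bool := co.1 (+) co.2.

Lemma weight_opener_or_closer h al :
  weight h (opener_or_closer :: al) =
    (0 < h) * (visit h.-1 * weight h.-1 al) + visit h.+1 * weight h.+1 al.
Proof. by rewrite weightS !mul0n addn0 !mul1n add0n mulnA. Qed.

(** Taken two positions at a time, the even heights obey the closed system w0' = w0 + 2 w2, w2' = w0
    + 4 w2 + w4, w4' = 2 w2 + w4. Its eigenvalues are 0, 1 and 5, and starting at length 2 removes
    the eigenvalue 0. *)
Lemma weight_matchings n (al := nseq (2 * n.+1) opener_or_closer) :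
  [/\ 2 * weight 0 al = 5 ^ n + 1, weight 2 al = 5 ^ n & 2 * weight 4 al + 1 = 5 ^ n].
Proof.
rewrite {}/al; elim: n => [|n].
  by rewrite muln1 [nseq _ _]/= !weight_opener_or_closer.
have -> : nseq (2 * n.+2) opener_or_closer =
    [:: opener_or_closer, opener_or_closer & nseq (2 * n.+1) opener_or_closer] by rewrite mulnS.
move: (nseq _ _) => al [w0 w2 w4].
rewrite expnS !weight_opener_or_closer !succnK.
have [-> [-> [-> ->]]] : visit 0 = 1 /\ visit 1 = 1 /\ visit 2 = 2 /\ visit 3 = 1 by [].
by have [-> ->] : visit 4 = 1 /\ visit 5 = 0 by []; split; lia.
Qed.

(** * Formal power series and linear recurrences *)

Section Series.

Local Open Scope ring_scope.

(** Truncation reduces the product of series to that of polynomials, from which commutativity and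
    associativity are inherited. *)
Lemma coef_fps_mul (N : nat) a b n : (n < N)%N ->
  ((\poly_(i < N) a i) * (\poly_(i < N) b i))`_n = fps_mul a b n.
Proof.
move=> nN; rewrite coefM; apply: eq_bigr => i _.
by rewrite !coef_poly (leq_ltn_trans (leq_ord i) nN) (leq_ltn_trans (leq_subr i n) nN).
Qed.

Lemma fps_mulC a b : fps_mul a b =1 fps_mul b a.
Proof. by move=> n; rewrite -!(@coef_fps_mul n.+1) // mulrC. Qed.

Lemma fps_mulA a b c : fps_mul a (fps_mul b c) =1 fps_mul (fps_mul a b) c.
Proof.
move=> n; set T := fun u : fps => \poly_(i < n.+1) u i.
transitivity ((T a * (T b * T c))`_n).
  rewrite coefM; apply: eq_bigr => i _.
  by rewrite coef_poly ltn_ord coef_fps_mul // ltnS leq_subr.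
rewrite mulrA coefM; apply: eq_bigr => i _.
by rewrite coef_fps_mul ?ltn_ord // coef_poly ltnS leq_subr.
Qed.

(** Peeling off the coefficients of a polynomial in Horner form turns its product with [f] into an
    explicit linear recurrence. *)
Lemma fps_mul_cons c p f n :
  fps_mul (fps_of_poly (cons_poly c p)) f n =
  c * f n + (if n is n'.+1 then fps_mul (fps_of_poly p) f n' else 0).
Proof.
rewrite fps_mul_recl /fps_of_poly coef_cons; congr (_ + _).
case: n => [|n]; first by rewrite big_ord0.
by apply: eq_bigr => i _; rewrite coef_cons subSS.
Qed.

Lemma fps_mul0 f n : fps_mul (fps_of_poly 0) f n = 0.
Proof. by rewrite /fps_mul big1 // => i _; rewrite /fps_of_poly coef0 mul0r. Qed.

Lemma fps_mul_tail f n :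
  (if n is n'.+1 then fps_mul (fps_of_poly 0%:P) f n' else 0) = 0.
Proof. by case: n => // n; rewrite polyC0 fps_mul0. Qed.

Lemma eq_fps_mull a a' b : a =1 a' -> fps_mul a b =1 fps_mul a' b.
Proof. by move=> aa' n; apply: eq_bigr => i _; rewrite aa'. Qed.

Lemma fps_divP p q f : q 0%N != 0 -> fps_mul q f =1 p -> f =1 fps_div p q.
Proof.
move=> q0 qf n; rewrite /fps_div -(eq_fps_mull _ (fun i => etrans (fps_mulC f q i) (qf i))).
rewrite -fps_mulA fps_mulC (eq_fps_mull _ (fps_mulrV q0)).
have -> : 1 = cons_poly 1 0 :> {poly rat} by rewrite cons_poly_def mul0r add0r.
by rewrite fps_mul_cons mul1r; case: n => [|n]; rewrite ?fps_mul0 addr0.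
Qed.

Definition partition_weight (n h : nat) : rat := (weight h (nseq n xpredT))%:R.

(** This is the transfer matrix on the heights 0 to 4. A diagonal entry adds 1 for an isolated
    position to [visit h.-1 * visit h] for one that closes an arc and then opens one. *)
Lemma partition_weightS n :
  [/\ partition_weight n.+1 0 = partition_weight n 0 + partition_weight n 1,
      partition_weight n.+1 1 =
        partition_weight n 0 + 2%:R * partition_weight n 1 + 2%:R * partition_weight n 2,
      partition_weight n.+1 2 =
        partition_weight n 1 + 3%:R * partition_weight n 2 + partition_weight n 3,
      partition_weight n.+1 3 =
        2%:R * partition_weight n 2 + 3%:R * partition_weight n 3 + partition_weight n 4 &
      partition_weight n.+1 4 = partition_weight n 3 + 2%:R * partition_weight n 4].
Proof.
by split; rewrite /partition_weight [nseq _.+1 _]/= weightS /= -?natrM -!natrD; congr _%:R; lia.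
Qed.

Lemma partition_weight0S n : partition_weight n.+1 0 = partition_weight n 0 + partition_weight n 1.
Proof. by case: (partition_weightS n). Qed.

Lemma partition_weight1S n : partition_weight n.+1 1 =
  partition_weight n 0 + 2%:R * partition_weight n 1 + 2%:R * partition_weight n 2.
Proof. by case: (partition_weightS n). Qed.

Lemma partition_weight2S n : partition_weight n.+1 2 =
  partition_weight n 1 + 3%:R * partition_weight n 2 + partition_weight n 3.
Proof. by case: (partition_weightS n). Qed.

Lemma partition_weight3S n : partition_weight n.+1 3 =
  2%:R * partition_weight n 2 + 3%:R * partition_weight n 3 + partition_weight n 4.
Proof. by case: (partition_weightS n). Qed.

Lemma partition_weight4S n : partition_weight n.+1 4 = partition_weight n 3 + 2%:R * partition_weight n 4.
Proof. by case: (partition_weightS n). Qed.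

Lemma partitions_series :
  (fun n => partition_weight n 0) =1
  fps_div
    (fps_of_poly (1 - 10%:R *: 'X + 32%:R *: 'X^2 - 37%:R *: 'X^3 + 12%:R *: 'X^4))
    (fps_of_poly ((1 - 'X) * (1 - 10%:R *: 'X + 31%:R *: 'X^2 - 30%:R *: 'X^3 + 'X^4))).
Proof.
(* Expanded, the denominator is det(1 - zT), with T the transfer matrix of [partition_weightS]. *)
have -> : (1 - 'X) * (1 - 10%:R *: 'X + 31%:R *: 'X^2 - 30%:R *: 'X^3 + 'X^4) =
    Poly [:: 1; - 11%:R; 41%:R; - 61%:R; 31%:R; - 1] :> {poly rat}.
  rewrite mulrBl mul1r; apply/polyP => i; rewrite coef_Poly !(coefE, coefXn, coef1, coefX).
  by case: i => [|[|[|[|[|[|i]]]]]] //=; rewrite nth_nil; ring.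
have -> : 1 - 10%:R *: 'X + 32%:R *: 'X^2 - 37%:R *: 'X^3 + 12%:R *: 'X^4 =
    Poly [:: 1; - 10%:R; 32%:R; - 37%:R; 12%:R] :> {poly rat}.
  apply/polyP => i; rewrite coef_Poly !(coefE, coefXn, coef1, coefX).
  by case: i => [|[|[|[|[|[|i]]]]]] //=; rewrite nth_nil; ring.
apply: fps_divP; first by rewrite /fps_of_poly coef_Poly.
have b0 h : partition_weight 0 h = (h == 0%N)%:R by [].
move=> n; rewrite [RHS]/fps_of_poly coef_Poly [Poly _]/=.
case: n => [|[|[|[|[|n]]]]]; rewrite !fps_mul_cons ?fps_mul0 /=
  ?(partition_weight0S, partition_weight1S, partition_weight2S, partition_weight3S,
    partition_weight4S) ?b0 /=; try ring.
(* From degree 5 on the recurrence is the Cayley-Hamilton relation of T, an identity in the five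
   weights at length [n]. *)
rewrite fps_mul_tail nth_nil.
move: (partition_weight n 0) (partition_weight n 1) (partition_weight n 2).
move: (partition_weight n 3) (partition_weight n 4) => a b c d e.
ring.
Qed.

Lemma weight_matchings_closed n :
  (weight 0 (nseq (2 * n.+1) opener_or_closer))%:R = (5%:R ^+ n + 1) / 2%:R :> rat.
Proof.
have [w _ _] := weight_matchings n; move: (weight 0 _) w => w0 w.
by rewrite -natrX -[1]/(1%:R) -natrD -w natrM mulrC mulKf.
Qed.

Lemma matchings_series :
  (fun n => (weight 0 (nseq (2 * n) opener_or_closer))%:R) =1
  fps_div (fps_of_poly (1 - 5%:R *: 'X + 2%:R *: 'X^2))
          (fps_of_poly (1 - 6%:R *: 'X + 5%:R *: 'X^2)).
Proof.
have -> : 1 - 6%:R *: 'X + 5%:R *: 'X^2 = Poly [:: 1; - 6%:R; 5%:R] :> {poly rat}.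
  apply/polyP => i; rewrite coef_Poly !(coefE, coefXn, coef1, coefX).
  by case: i => [|[|[|i]]] //=; rewrite nth_nil; ring.
have -> : 1 - 5%:R *: 'X + 2%:R *: 'X^2 = Poly [:: 1; - 5%:R; 2%:R] :> {poly rat}.
  apply/polyP => i; rewrite coef_Poly !(coefE, coefXn, coef1, coefX).
  by case: i => [|[|[|i]]] //=; rewrite nth_nil; ring.
apply: fps_divP; first by rewrite /fps_of_poly coef_Poly.
move=> n; rewrite [RHS]/fps_of_poly coef_Poly [Poly _]/=.
(* The closed form fails for the coefficient 0, which enters the recurrence up to degree 2; these
   degrees are separate cases. *)
by case: n => [|[|[|n]]]; rewrite !fps_mul_cons ?fps_mul_tail ?weight_matchings_closed
  ?nth_nil ?muln0 //= ?polyC0 ?fps_mul0 ?nth_nil ?exprS; field.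
Qed.

End Series.

(** * Borders *)

Definition height_step (h : int) (s : step) : int :=
  if s == east then (h + 1)%R else (h - 1)%R.

Lemma heightsE w : heights w = 0%R :: scanl height_step 0%R w.
Proof. by []. Qed.

(** The height of a point is its excess x + y - n over the diagonal; this translates the condition
    on points into one on heights. *)
Lemma heights_path_points (n : nat) p w :
  [seq (q.1 + q.2 - n%:Z)%R | q <- scanl move p w] =
  scanl height_step (p.1 + p.2 - n%:Z)%R w.
Proof.
elim: w p => //= s w IHw p; rewrite IHw.
have -> : ((move p s).1 + (move p s).2 - n%:Z)%R = height_step (p.1 + p.2 - n%:Z)%R s.
  by rewrite /move /height_step; case: (s == east) => /=; ring.
by [].
Qed.

Lemma last_path_points p w :
  last p (scanl move p w) = ((p.1 + (count_mem east w)%:Z)%R, (p.2 - (count_mem south w)%:Z)%R).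
Proof.
elim: w p => [|s w IHw] p /=; first by rewrite addr0 subr0; case: p.
by rewrite IHw /move; case: s => /=; congr (_, _); lia.
Qed.

Lemma dyck_path_size n w : dyck_path n w -> size w = 2 * n.
Proof.
case/andP=> + _; rewrite /= last_path_points /= add0r.
case/eqP=> <- /eqP; rewrite subr_eq0 eqz_nat => /eqP eq_count_steps.
have := count_predC (pred1 east) w.
rewrite (eq_count (a1 := predC (pred1 east)) (a2 := pred1 south)); last by move=> -[].
by rewrite -eq_count_steps addnn mul2n.
Qed.

Lemma dyck_path_heights n w : dyck_path n w ->
  all (>= 0)%R (scanl height_step 0%R w) && (last 0%R (scanl height_step 0%R w) == 0%R).
Proof.
case/andP=> /eqP lastE /= /andP[_ ge0].
have := heights_path_points n (0, n%:Z)%R w; rewrite /= add0r subrr => <-.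
rewrite all_map; apply/andP; split.
  by apply: sub_all ge0 => p /=; lia.
have := last_map (fun q : int * int => (q.1 + q.2 - n%:Z)%R) (scanl move (0, n%:Z)%R w) (0, n%:Z)%R.
by rewrite /= add0r subrr => ->; move: lastE => /= ->; rewrite /= addr0 subrr.
Qed.

Lemma path_height_lt (h : nat) w : 0 < h ->
  (path_height w < h%:Z)%R = all (< h%:Z)%R (scanl height_step 0%R w).
Proof.
move=> h_gt0; rewrite /path_height heightsE big_cons gt_max ltz_nat h_gt0 /=.
elim: (scanl _ _ _) => [|k s IHs] /=; first by rewrite big_nil ltz_nat.
by rewrite big_cons gt_max IHs.
Qed.

Definition exact_types (w : seq step) : seq (pred (bool * bool)) :=
  [seq (fun co => co == (~~ b, b)) | b <- w].

Lemma weight_opener h al :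
  weight h ((fun co => co == (false, true)) :: al) = visit h.+1 * weight h.+1 al.
Proof. by rewrite weightS !mul0n mul1n addn0. Qed.

Lemma weight_closer h al :
  weight h ((fun co => co == (true, false)) :: al) = (0 < h) * (visit h.-1 * weight h.-1 al).
Proof. by rewrite weightS !mul0n mul1n !addn0 mulnA. Qed.

Lemma visitE (k : nat) :
  visit k = if (k%:Z < 5%:Z)%R then 2 ^ (k%:Z == 2)%R else 0.
Proof. by rewrite ltz_nat; case: k => [|[|[|[|[|k]]]]]. Qed.

(** With every type prescribed only one path remains, and its weight is the product of the factors
    [visit] over its points after the starting one. *)
Lemma weight_exact_types (h : nat) w (s := scanl height_step h%:Z%R w) :
  all (>= 0)%R s -> last h%:Z%R s = 0%R ->
  weight h (exact_types w) = if all (< 5%:Z)%R s then 2 ^ count_mem 2%R s else 0.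
Proof.
have visit_mul (k c : nat) b :
    visit k * (if b then 2 ^ c else 0) =
    if (k%:Z < 5%:Z)%R && b then 2 ^ ((k%:Z == 2)%R + c) else 0.
  by rewrite visitE; case: ifP; case: b; rewrite ?muln0 // expnD.
rewrite {}/s; elim: w h => [|b w IHw] h.
  by move=> _ /= /eqP; rewrite eqz_nat => /eqP->.
case: b; rewrite [exact_types _]/= ?weight_opener ?weight_closer [scanl _ _ (_ :: _)]/=.
  rewrite (_ : height_step h true = h.+1%:Z%R); last by rewrite /height_step /=; lia.
  by move=> /andP[_ ge0] lastE; rewrite (IHw _ ge0 lastE) visit_mul.
case: h => [|h]; first by [].
rewrite mul1n (_ : height_step h.+1 false = h%:Z%R); last by rewrite /height_step /=; lia.
by move=> /andP[_ ge0] lastE; rewrite (IHw _ ge0 lastE) visit_mul.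
Qed.

Local Open Scope ring_scope.

Theorem theorem6p3 :
  (forall (n : nat) (F : board), dyck_board n F ->
     #|matchings_of_shape n F pat123 pat321|
       = (if dyck_board_lt 5 n F then 2 ^ board_eta F else 0)%N)
  /\ (fun n => (#|matchings n pat123 pat321|%:R : rat))
       =1 fps_div (fps_of_poly (1 - 5%:R *: 'X + 2%:R *: 'X^2))
                  (fps_of_poly (1 - 6%:R *: 'X + 5%:R *: 'X^2))
  /\ (forall n : nat, (1 <= n)%N ->
        (#|matchings n pat123 pat321|%:R : rat) = (5%:R ^+ (n - 1)%N + 1) / 2%:R)
  /\ (fun n => (#|partitions n pat123 pat321|%:R : rat))
       =1 fps_div
            (fps_of_poly (1 - 10%:R *: 'X + 32%:R *: 'X^2 - 37%:R *: 'X^3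
                          + 12%:R *: 'X^4))
            (fps_of_poly ((1 - 'X) * (1 - 10%:R *: 'X + 31%:R *: 'X^2
                                      - 30%:R *: 'X^3 + 'X^4))).
Proof.
have matchings_card n : #|matchings n pat123 pat321| = weight 0 (nseq (2 * n) opener_or_closer).
  by rewrite matchingsE card_patternless // size_nseq.
split=> [n F dF|].
  have dw : dyck_path n (border F) by case/andP: dF.
  rewrite matchings_of_shapeE // ?(dyck_path_size dw) //.
  rewrite card_patternless ?size_map ?(dyck_path_size dw) //.
  have /andP[ge0 /eqP lastE] := dyck_path_heights dw.
  (* The height sequence has the additional first entry 0, which neither counts for [path_eta] nor
     violates the height bound. *)
  rewrite (@weight_exact_types 0) // /dyck_board_lt dF path_height_lt // /board_eta /path_eta.
split=> [n|]; first by rewrite matchings_card matchings_series.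
split=> [[//|n] _|n].
  by rewrite matchings_card weight_matchings_closed subn1.
rewrite -partitions_series /partition_weight card_partitions card_patternless ?size_nseq //.
Qed.
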